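(* Let $d\ge 2$ and let $n_1,\ldots,n_d$ be integers with $n_i\ge 2$ for $i=1,\ldots,d$. Then the Cartesian product of paths $P_{n_1}\square\cdots\square P_{n_d}$ is RN.
   Context: $P_n$ denotes the path on $n$ vertices and $\square$ the Cartesian product of graphs, so $P_{n_1}\square\cdots\square P_{n_d}$ has vertex set $\{(a_1,\ldots,a_d):1\le a_i\le n_i\}$, with two vertices adjacent if and only if they differ by one in exactly one coordinate and agree in all others. Let $G=(V,E)$ be a finite simple connected graph with set of spanning trees $\mathcal T(G)$. For a positive conductance function $c:E\to\mathbb R_{>0}$ and an edge $uv\in E$, the relative resistance is $r_{uv}(c)=c_{uv}\,\omega_{uv}(c)$, where $\omega_{uv}(c)$ is the effective resistance between $u$ and $v$ in the electrical network in which each edge $e$ has resistance $c_e^{-1}$; equivalently, $$r_{uv}(c)=\frac{\sum_{T\in\mathcal T(G):\,uv\in E(T)}\prod_{e\in E(T)}c_e}{\sum_{T\in\mathcal T(G)}\prod_{e\in E(T)}c_e}.$$ The resistance curvature at $v\in V$ is $p_v(c)=1-\frac12\sum_{u:\,uv\in E}r_{uv}(c)$. $G$ is resistance nonnegative (RN) if there exists $c:E\to\mathbb R_{>0}$ with $p_v(c)\ge 0$ for every $v\in V$. The paper uses the following known characterization (Devriendt): $G$ is RN if and only if there is a point $x\in P(G)^\circ$ with $\sum_{u:\,uv\in E}x_{uv}\le 2$ for every $v\in V$, where $P(G)^\circ$ is the relative interior of the spanning tree polytope $P(G)=\operatorname{conv}\{\chi^T:T\in\mathcal T(G)\}\subseteq\mathbb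 R^E$. *)

(* Defs.v *)
From HB Require Import structures.
From mathcomp Require Import all_boot all_order all_algebra.
From mathcomp Require Import all_classical all_reals.
Set Implicit Arguments.
Unset Strict Implicit.
Unset Printing Implicit Defensive.
Import Order.TTheory GRing.Theory Num.Theory.

Local Open Scope ring_scope.

Record cgraph := CGraph {
  vertex :> finType;
  adj : rel vertex;
  adj_sym : symmetric adj;
  adj_irr : irreflexive adj;
  adj_connected : forall x y : vertex, connect adj x y }.

Section Path.
Variable n : nat.

Definition path_adj : rel 'I_n := fun i j => (i.+1 == j :> nat) || (j.+1 == i :> nat).

Lemma path_adj_sym : symmetric path_adj.
Proof. by move=> i j; rewrite /path_adj orbC. Qed.

Lemma path_adj_irr : irreflexive path_adj.
Proof. by move=> i; rewrite /path_adj orbb -addn1 -[X in _ == X]addn0 eqn_add2l. Qed.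

Lemma path_adj_connected (i j : 'I_n) : connect path_adj i j.
Proof.
have up k : forall x y : 'I_n, y = (x + k)%N :> nat -> connect path_adj x y.
  elim: k => [|k IHk] x y hxy.
    by rewrite (_ : y = x) ?connect0 //; apply/val_inj; rewrite /= hxy addn0.
  have hk : (x + k < n)%N.
    by apply: leq_trans (ltn_ord y); rewrite hxy addnS ltnS.
  apply: connect_trans (IHk x (Ordinal hk) erefl) _.
  by apply: connect1; rewrite /path_adj /= hxy addnS eqxx.
have [le_ij|/ltnW le_ji] := leqP i j.
  by apply: (up (j - i)%N); rewrite subnKC.
rewrite (sym_connect_sym path_adj_sym).
by apply: (up (i - j)%N); rewrite subnKC.
Qed.

Definition path_graph : cgraph :=
  CGraph path_adj_sym path_adj_irr path_adj_connected.

End Path.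

Section CartesianProduct.
Variables (I : finType) (G : I -> cgraph).
Local Notation V := {dffun forall i : I, G i}.

Definition cprod_adj : rel V := fun a b =>
  [exists i, adj (a i) (b i) && [forall (j | j != i), a j == b j]].

Lemma cprod_adj_sym : symmetric cprod_adj.
Proof.
move=> a b; apply: eq_existsb => i; rewrite adj_sym; congr andb.
by apply: eq_forallb => j; rewrite (eq_sym (a j)).
Qed.

Lemma cprod_adj_irr : irreflexive cprod_adj.
Proof. by move=> a; apply/negbTE/existsP => -[i]; rewrite adj_irr. Qed.

Lemma cprod_adj_connected (a b : V) : connect cprod_adj a b.
Proof.
pose upd (c : V) i (x : G i) : V := [ffun j => @eqtype.dfwith I (fun k => G k) c i x j].
have step (c : V) i (x y : G i) : connect cprod_adj (upd c i x) (upd c i y).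
  have /connectP[p hp ->] := adj_connected x y.
  elim: p x hp => [|z p IHp] x /=; first by rewrite connect0.
  case/andP=> xz hp; apply: connect_trans (IHp z hp); apply: connect1.
  apply/existsP; exists i; rewrite !ffunE !eqtype.dfwith_in xz /=.
  by apply/forall_inP => j ji; rewrite !ffunE !eqtype.dfwith_out // eq_sym.
pose mix (s : seq I) : V := [ffun j => if j \in s then b j else a j].
have mixP s : connect cprod_adj a (mix s).
  elim: s => [|i s IHs].
    by rewrite (_ : mix [::] = a) ?connect0 //; apply/ffunP => j; rewrite ffunE.
  apply: connect_trans IHs _.
  have -> : mix s = upd (mix s) i (mix s i).
    apply/ffunP => j; rewrite [RHS]ffunE; case: eqtype.dfwithP => // k _.
  have -> : mix (i :: s) = upd (mix s) i (b i).
    apply/ffunP => j; rewrite [RHS]ffunE; case: eqtype.dfwithP => [|k ki].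
      by rewrite ffunE mem_head.
    by rewrite !ffunE inE eq_sym (negPf ki).
  exact: step.
have -> : b = mix (enum I); last exact: mixP.
by apply/ffunP => j; rewrite ffunE mem_enum.
Qed.

Definition cprod_graph : cgraph :=
  CGraph cprod_adj_sym cprod_adj_irr cprod_adj_connected.

End CartesianProduct.

Section Resistance.
Variables (R : realType) (G : cgraph).

(* An edge uv is the set [set u; v]; a conductance function only matters, and *)
(* is only required to be positive, on edges.                                 *)
Definition conductance (c : {set G} -> R) : Prop :=
  forall u v : G, adj u v -> 0 < c [set u; v].

(* phi is the potential of a unit current flow from u to v: by Ohm's law the  *)
(* edge xy carries current c_xy (phi x - phi y), and Kirchhoff's current law  *)
(* holds with a unit current injected at u and extracted at v.                *)
Definition unit_potential (c : {set G} -> R) (u v : G) (phi : {ffun G -> R}) :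
    Prop :=
  forall x : G, \sum_(y : G | adj x y) c [set x; y] * (phi x - phi y)
                = (x == u)%:R - (x == v)%:R.

(* For a conductance c on the connected graph G, such a phi exists and is     *)
(* unique up to an additive constant, so the choice made by xget is immaterial. *)
Definition effective_resistance (c : {set G} -> R) (u v : G) : R :=
  let phi := xget 0 [set phi | unit_potential c u v phi]%classic in
  phi u - phi v.

Definition relative_resistance (c : {set G} -> R) (u v : G) : R :=
  c [set u; v] * effective_resistance c u v.

Definition resistance_curvature (c : {set G} -> R) (v : G) : R :=
  1 - 2^-1 * \sum_(u : G | adj u v) relative_resistance c u v.

Definition resistance_nonnegative : Prop :=
  exists c : {set G} -> R,
    conductance c /\ forall v : G, 0 <= resistance_curvature c v.

End Resistance.

Arguments resistance_nonnegative R G : clear implicits.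

(* Main.v *)
Require Import Defs.
From mathcomp Require Import all_boot all_order all_algebra.
From mathcomp Require Import all_classical all_reals.
From mathcomp Require Import all_analysis.
From mathcomp Require Import ring lra zify.

(** The criterion.  For a weighted graph write D(c) for the determinant of the
Laplacian plus the all-ones matrix; up to a constant it is the weighted count
of spanning trees.  Given a list of N spanning trees T, minimise the product
over the list of D(c) / c^T, where c^T is the product of the conductances on
T.  Since D is affine in each c_e with slope D times the effective resistance
across e, the vanishing of the partial derivatives at a minimum says that the
relative resistance of every edge e is the proportion of trees of the list
that use e ([exists_leverage_eq_usage]).  The sum of the relative resistances
at a vertex is then its average degree in the list, and the curvature is
nonnegative as soon as all these averages are at most 2
([resistance_nonnegative_trees]).

A minimum exists when the objective controls all ratios c_f / c_g.  Keeping
only the rank-one terms of one tree bounds D(c) below by a multiple of c^T, for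
every spanning tree T, listed or not.  If T is listed and T - g + f is also a
tree, the bound for T - g + f gives D(c) / c^T at least a constant times
c_f / c_g.  Thus coercivity follows once every edge can be led to every other
one by such exchanges.

The trees.  A product of at least two paths contains a spanning
two-dimensional grid: one side is a factor, the other side is a Hamiltonian
path of the product of the remaining factors.  The grid has four boustrophedon
Hamiltonian paths (along rows or columns, and their mirror images), all of
degree at most 2.  Replacing in such a path P an edge of P by a chord whose
ends it separates on P gives a tree.  Between the ends of a vertical edge the
row path runs through all horizontal edges that lie in the two rows concerned
and to one side of that edge; the mirror image of the path serves the other
side.  With the same for columns, the exchanges lead from any grid edge to all
grid edges ([grid_exchange]), and they lead from any other edge of the product
to a grid edge.

It remains to reach an edge f outside the grid.  Write f = xy, and replace by
f the edge of P at y that points towards x: the tree so obtained contains f,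
and only the degree of x has increased.  It may be added to the list if x has
slack, that is, if some list of trees with average degrees at most 2 has
average degree less than 2 at x.  A corner of the grid is an end of a
Hamiltonian path and has slack.  The same replacement moves slack from x to
the other end of the deleted edge, which in the grid is a diagonal neighbour
of x, so that the whole colour class of the corner has slack ([slack_even]).
The graph is bipartite, hence every edge has one end in that class.  This
covers all parities of the sides at once, including the case where they are
all odd: there is then no Hamiltonian cycle, and every degree average in the
other colour class is forced to be exactly 2. *)

Set Implicit Arguments.
Unset Strict Implicit.
Unset Printing Implicit Defensive.
Import Order.TTheory GRing.Theory Num.Theory.
Import numFieldNormedType.Exports.

(** * Sums of rank-one matrices and their determinants *)

Section MatrixDeterminantLemma.
Local Open Scope ring_scope.

(** The two sides come from eliminating the last row of the bordered matrix
with blocks P, - u, v, 1, once with the corner 1 and once with P. *)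
Lemma det_rank_one (F : fieldType) n (P : 'M[F]_n) (u : 'cV_n) (v : 'rV_n) :
  P \in unitmx ->
  \det (P + u *m v) = \det P * (1 + (v *m invmx P *m u) 0 0).
Proof.
move=> Pu; pose X := block_mx P (- u) v 1%:M.
have E1 : X *m block_mx 1%:M 0 (- v) 1%:M = block_mx (P + u *m v) (- u) 0 1%:M.
  rewrite mulmx_block !mulmx1 !mulmx0 !mul1mx mulmxN mulNmx opprK !add0r.
  by rewrite addrN.
have E2 : block_mx 1%:M 0 (- (v *m invmx P)) 1%:M *m X
        = block_mx P (- u) 0 (1%:M + v *m invmx P *m u).
  rewrite mulmx_block !mul1mx !mul0mx !addr0 !mulNmx mulmxN opprK.
  by rewrite mulmxKV // addNr addrC.
have := congr1 determinant E1.
rewrite det_mulmx det_lblock !det1 !mulr1 det_ublock det1 mulr1 => <-.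
have := congr1 determinant E2.
rewrite det_mulmx det_lblock !det1 !mul1r det_ublock => ->.
by rewrite [X in _ * X]det_mx11 !mxE eqxx.
Qed.

End MatrixDeterminantLemma.

Section RankOneSums.
Local Open Scope ring_scope.
Variable R : realFieldType.
Implicit Types n : nat.

Definition posdef n (P : 'M[R]_n) :=
  P^T = P /\ forall u : 'rV_n, u != 0 -> 0 < (u *m P *m u^T) 0 0.

Lemma posdef_unitmx n (P : 'M[R]_n) : posdef P -> P \in unitmx.
Proof.
case=> _ Ppos; rewrite unitmxE unitfE; apply/negP => /det0P[v v0 vP].
by have := Ppos v v0; rewrite vP mul0mx mxE ltxx.
Qed.

Lemma posdef_inv_ge0 n (P : 'M[R]_n) (u : 'rV_n) :
  posdef P -> 0 <= (u *m invmx P *m u^T) 0 0.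
Proof.
move=> Pp; have Pu := posdef_unitmx Pp; case: Pp => Psym Ppos.
have -> : u *m invmx P *m u^T = (u *m invmx P) *m P *m (u *m invmx P)^T.
  by rewrite mulmxKV // trmx_mul trmx_inv Psym mulmxA.
have [->|/Ppos/ltW//] := eqVneq (u *m invmx P) 0.
by rewrite !mul0mx mxE.
Qed.

Lemma quad_rank_one n (u b : 'rV[R]_n) :
  (u *m (b^T *m b) *m u^T) 0 0 = ((u *m b^T) 0 0) ^+ 2.
Proof.
have bu : b *m u^T = (u *m b^T)^T by rewrite trmx_mul trmxK.
by rewrite mulmxA -mulmxA mxE big_ord1 bu [_^T _ _]mxE expr2.
Qed.

Lemma posdef_add_rank_one n (P : 'M[R]_n) (b : 'rV_n) (t : R) :
  posdef P -> 0 <= t -> posdef (P + t *: (b^T *m b)).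
Proof.
move=> [Psym Ppos] t0; split; first by rewrite linearD linearZ /= trmx_mul trmxK Psym.
move=> u u0; rewrite mulmxDr mulmxDl mxE -scalemxAr -scalemxAl [X in _ + X]mxE.
by rewrite quad_rank_one ltr_wpDr ?Ppos // mulr_ge0 // sqr_ge0.
Qed.

Lemma det_add_rank_one n (P : 'M[R]_n) (b : 'rV_n) (t : R) :
  P \in unitmx ->
  \det (P + t *: (b^T *m b)) = \det P * (1 + t * (b *m invmx P *m b^T) 0 0).
Proof.
move=> Pu; rewrite scalemxAl det_rank_one //.
by rewrite -scalemxAr [X in _ + X]mxE.
Qed.

Variables (n : nat) (K : finType) (b : K -> 'rV[R]_n).
Implicit Types (c : K -> R) (T : {ffun 'I_n -> K}).

(** For the rows of an incidence matrix this is the weighted Laplacian. *)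
Definition gram c : 'M[R]_n := \sum_k c k *: ((b k)^T *m b k).

Definition frame T : 'M[R]_n := \matrix_i b (T i).

Definition is_base T := \det (frame T) != 0.

Lemma base_inj T : is_base T -> injective T.
Proof.
move=> Tb i j Tij; apply/eqP; apply: contraNT Tb => nij; apply/eqP.
by apply: (determinant_alternate nij) => k; rewrite !mxE Tij.
Qed.

Lemma base_gram c T :
  \sum_i c (T i) *: ((b (T i))^T *m b (T i))
  = (frame T)^T *m diag_mx (\row_i c (T i)) *m frame T.
Proof.
apply/matrixP => x y; rewrite summxE mxE; apply: eq_bigr => i _.
rewrite !mxE big_ord1 !mxE (bigD1 i) //= big1 => [|j ji]; last first.
  by rewrite !mxE (negPf ji) mulr0n mulr0.
by rewrite !mxE eqxx mulr1n addr0 mulrCA mulrA.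
Qed.

Lemma posdef_base_gram c T : is_base T -> (forall i, 0 < c (T i)) ->
  posdef (\sum_i c (T i) *: ((b (T i))^T *m b (T i))).
Proof.
move=> Tb c0; split.
  by rewrite linear_sum; apply: eq_bigr => i _; rewrite linearZ /= trmx_mul trmxK.
move=> u u0; rewrite mulmx_sumr mulmx_suml summxE.
have q i : (u *m (c (T i) *: ((b (T i))^T *m b (T i))) *m u^T) 0 0
   = c (T i) * ((u *m (b (T i))^T) 0 0) ^+ 2.
  by rewrite -scalemxAr -scalemxAl mxE quad_rank_one.
have q0 i : 0 <= (u *m (c (T i) *: ((b (T i))^T *m b (T i))) *m u^T) 0 0.
  by rewrite q mulr_ge0 ?sqr_ge0 ?ltW.
rewrite lt_def sumr_ge0 // andbT psumr_eq0 //.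
apply: contraNN Tb => /allP all0; rewrite -det_tr.
apply/det0P; exists u => //; apply/rowP => i.
have := all0 i; rewrite mem_index_enum q mulf_eq0 gt_eqF //= sqrf_eq0.
move=> /(_ isT)/eqP ui0; rewrite [RHS]mxE -[RHS]ui0 !mxE.
by apply: eq_bigr => j _; rewrite !mxE.
Qed.

Lemma det_base_gram c T :
  \det (\sum_i c (T i) *: ((b (T i))^T *m b (T i)))
  = \det (frame T) ^+ 2 * \prod_i c (T i).
Proof.
rewrite base_gram !det_mulmx det_tr det_diag mulrAC -expr2; congr (_ * _).
by apply: eq_bigr => i _; rewrite mxE.
Qed.

(** Each added term multiplies the determinant by 1 + c_k b P^-1 b^T, which is
at least 1. *)
Lemma det_ge_sum_rank_one (P : 'M[R]_n) (s : seq K) c : posdef P -> 0 <= \det P ->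
  (forall k, 0 <= c k) ->
  let Q := P + \sum_(k <- s) c k *: ((b k)^T *m b k) in
  posdef Q /\ \det P <= \det Q.
Proof.
move=> Pp P0 c0 /=; elim: s => [|k s [Qp Qd]].
  by rewrite big_nil addr0.
rewrite big_cons addrCA addrC; set Q := P + _ in Qp Qd *; split.
  exact: posdef_add_rank_one.
rewrite det_add_rank_one ?posdef_unitmx //; apply: (le_trans Qd).
rewrite ler_peMr ?(le_trans P0) // lerDl mulr_ge0 //.
exact: posdef_inv_ge0.
Qed.

(** One term of the Cauchy-Binet expansion of the determinant already bounds it
below: start from the rank-one terms of the base and add the others. *)
Lemma gram_ge_base c T : is_base T -> (forall k, 0 < c k) ->
  posdef (gram c) /\ \det (frame T) ^+ 2 * \prod_i c (T i) <= \det (gram c).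
Proof.
move=> Tb c0; set P := \sum_i c (T i) *: ((b (T i))^T *m b (T i)).
have -> : gram c = P + \sum_(k <- enum [predC codom T]) c k *: ((b k)^T *m b k).
  rewrite big_enum /= /gram (bigID [in codom T]) /=; congr (_ + _).
  rewrite -big_uniq /=; first by rewrite codomE big_map big_enum.
  exact/injectiveP/base_inj.
rewrite -det_base_gram -/P; apply: det_ge_sum_rank_one.
- exact: posdef_base_gram.
- rewrite det_base_gram mulr_ge0 ?sqr_ge0 // prodr_ge0 // => i _; exact: ltW.
- by move=> k; apply: ltW.
Qed.

Lemma det_gram_gt0 c T : is_base T -> (forall k, 0 < c k) -> 0 < \det (gram c).
Proof.
move=> Tb c0; have [_] := gram_ge_base Tb c0; apply: lt_le_trans.
by rewrite mulr_gt0 ?prodr_gt0 // exprn_even_gt0 // orbT.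
Qed.

(** In a network this is conductance times effective resistance. *)
Definition leverage c k := c k * (b k *m invmx (gram c) *m (b k)^T) 0 0.

(** Foster's identity: the sum is the trace of the identity matrix. *)
Lemma sum_leverage c : gram c \in unitmx -> \sum_k leverage c k = n%:R.
Proof.
move=> Pu; transitivity (\tr (gram c *m invmx (gram c))); last first.
  by rewrite mulmxV // mxtrace1.
rewrite {2}/gram mulmx_suml linear_sum; apply: eq_bigr => k _.
rewrite -scalemxAl linearZ /= /leverage; congr (_ * _).
by rewrite -[in RHS]mulmxA mxtrace_mulC [RHS]trace_mx11.
Qed.

(** The determinant is affine in each coefficient, and its logarithmic slope is
the leverage divided by the coefficient. *)
Lemma det_gram_update c c' k t : gram c \in unitmx ->
  c' =1 (fun j => if j == k then c k + t else c j) ->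
  \det (gram c') = \det (gram c) * (1 + t * (b k *m invmx (gram c) *m (b k)^T) 0 0).
Proof.
move=> Pu c'E; rewrite -det_add_rank_one //; congr determinant.
rewrite /gram (bigD1 k) //= c'E eqxx [in RHS](bigD1 k) //= scalerDl.
rewrite addrAC; congr (_ + _ + _); apply: eq_bigr => j jk.
by rewrite c'E (negPf jk).
Qed.

End RankOneSums.

(** * Coercivity of the objective *)

Section Realization.
Local Open Scope ring_scope.
Variable R : realType.

(** The polynomial (1 + ta)^p - (1 + tb)^q has a local minimum at t = 0, where its
derivative is ap - bq. *)
Lemma slope_at_contact (a b d : R) p q : 0 < d ->
  (forall t, `|t| < d -> (1 + t * b) ^+ q <= (1 + t * a) ^+ p) ->
  a * p%:R = b * q%:R.
Proof.
move=> d0 le_ba.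
pose P : {poly R} := (a *: 'X + 1) ^+ p - (b *: 'X + 1) ^+ q.
have PE t : P.[t] = (1 + t * a) ^+ p - (1 + t * b) ^+ q.
  by rewrite /P !hornerE (addrC 1) (addrC 1) ![t * _]mulrC.
have min0 : is_derive (0 : R) (1 : R) (horner P) 0.
  apply: (@derive1_at_min R _ (- d) d).
  - by rewrite ge0_cp // ltW.
  - by move=> t _; apply: derivable_horner.
  - by rewrite in_itv /= oppr_lt0 d0.
  move=> t; rewrite in_itv /= => td.
  rewrite !PE !mul0r !addr0 !expr1n subrr subr_ge0 le_ba //.
  by rewrite ltr_norml.
have E : P^`().[0] = 0.
  have D0 := @derive_val _ _ _ _ _ _ _ min0.
  by have := @derive_val _ _ _ _ _ _ _ (is_derive_poly P 0); rewrite D0.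
move: E; rewrite /P !derivCE !hornerE /= !hornerMn !hornerE /=.
rewrite !expr1n !mulr1 => /eqP; rewrite subr_eq0 => /eqP.
by rewrite -(mulr_natr a) -(mulr_natr b).
Qed.

Lemma prod_ge_const (T : eqType) (s : seq T) (F : T -> R) (kappa : R) :
  0 <= kappa -> (forall x, x \in s -> kappa <= F x) ->
  kappa ^+ size s <= \prod_(x <- s) F x.
Proof.
move=> k0 le_kF; rewrite -(count_predT s) -iter_mulr_1 -big_const_seq.
rewrite !(big_seq_cond xpredT); apply: ler_prod => x /andP[xs _].
by rewrite k0 le_kF.
Qed.

Variables (n : nat) (K : finType) (b : K -> 'rV[R]_n).

Definition substitute (T : {ffun 'I_n -> K}) (i : 'I_n) (f : K) :=
  [ffun j => if j == i then f else T j].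

(** Along this relation the objective below bounds the ratio c_f / c_g. *)
Definition exchange (fam : seq {ffun 'I_n -> K}) (f g : K) :=
  has (fun T : {ffun 'I_n -> K} =>
    [exists i, (T i == g) && is_base b (substitute T i f)]) fam.

Definition usage (fam : seq {ffun 'I_n -> K}) (k : K) :=
  (\sum_(T <- fam) #|[pred i | T i == k]|)%N.

Local Notation weight c T := (\prod_i c (T i)).

Lemma weight_substitute (c : K -> R) T i f : (forall k, 0 < c k) ->
  weight c (substitute T i f) = weight c T * (c f / c (T i)).
Proof.
move=> c0; rewrite (bigD1 i) //= ffunE eqxx [in RHS](bigD1 i) //=.
rewrite [X in _ * X = _](eq_bigr (fun j => c (T j))); last first.
  by move=> j ji; rewrite ffunE (negPf ji).
by field; rewrite gt_eqF.
Qed.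

(** There are finitely many bases, so the constants of [gram_ge_base] have a
positive lower bound. *)
Lemma base_weight_bound : exists2 kappa : R, 0 < kappa &
  forall T, is_base b T -> forall c : K -> R, (forall k, 0 < c k) ->
  kappa <= \det (gram b c) / weight c T.
Proof.
exists (\prod_(T | is_base b T) Num.min 1 (\det (frame b T) ^+ 2)).
  apply: prodr_gt0 => T Tb; rewrite lt_min ltr01 /=.
  by rewrite exprn_even_gt0 // Tb orbT.
move=> T Tb c c0; rewrite ler_pdivlMr ?prodr_gt0 //.
have [_] := gram_ge_base Tb c0; apply: le_trans.
rewrite ler_wpM2r //; first by apply: prodr_ge0 => i _; apply: ltW.
have m01 T' : 0 <= Num.min 1 (\det (frame b T') ^+ 2) <= 1.
  by rewrite ge_min lexx le_min ler01 sqr_ge0.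
rewrite (bigD1 T) //=; apply: (@le_trans _ _ (Num.min 1 (\det (frame b T) ^+ 2))).
  have /andP[m0 _] := m01 T; rewrite ler_piMr //.
  by apply: prodr_ile1 => T' _.
by rewrite ge_min lexx orbT.
Qed.

Variable fam : seq {ffun 'I_n -> K}.
Hypothesis fam_base : forall T, T \in fam -> is_base b T.

(** At a stationary point the leverage of k is the proportion of the family that
uses k. *)
Definition objective (c : K -> R) : R :=
  \prod_(T <- fam) (\det (gram b c) / weight c T).

(** In the factor of the member T that allows the exchange, bound the determinant
below by the weight of the exchanged base, which is that of T times c_f / c_g. *)
Lemma objective_ge_ratio : exists2 kappa : R, 0 < kappa &
  forall c f g, (forall k, 0 < c k) -> exchange fam f g ->
  kappa * (c f / c g) <= objective c.
Proof.
have [k k0 kP] := base_weight_bound; exists (k ^+ size fam); first exact: exprn_gt0.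
move=> c f g c0 /hasP[T Tfam /existsP[i /andP[/eqP <- Tb]]].
rewrite /objective (big_rem T) //=.
have -> : size fam = (size (rem T fam)).+1.
  by rewrite size_rem // prednK // lt0n size_eq0; case: (fam) Tfam.
rewrite exprS mulrAC; apply: ler_pM.
- by rewrite ltW // mulr_gt0 // divr_gt0.
- by rewrite exprn_ge0 // ltW.
- have := kP _ Tb c c0; rewrite weight_substitute // invfM mulrA.
  by rewrite ler_pdivlMr // divr_gt0.
- apply: prod_ge_const; first exact: ltW.
  by move=> T' /mem_rem /fam_base T'b; apply: kP.
Qed.

(** Multiply the bounds of [objective_ge_ratio] along a path without repetition,
whose length is at most the number of indices. *)
Lemma sublevel_ratio (A : K -> Prop) :
  (forall f g, A f -> A g -> connect (exchange fam) f g) ->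
  forall M, exists2 L : R, 1 <= L &
  forall c f g, (forall k, 0 < c k) -> objective c <= M ->
  A f -> A g -> c f <= L * c g.
Proof.
move=> Aconn M; have [k k0 kP] := objective_ge_ratio.
pose Q := Num.max 1 (M / k); have Q1 : 1 <= Q by rewrite le_max lexx.
exists (Q ^+ #|K|); first exact: exprn_ege1.
move=> c f g c0 cM Af Ag; have /connectP[p0 fp0 ->] := Aconn f g Af Ag.
case/shortenP: fp0 => p fp up _.
have step x y : exchange fam x y -> c x <= Q * c y.
  move=> xy; rewrite -ler_pdivrMr // le_max; apply/orP; right.
  by rewrite ler_pdivlMr // mulrC (le_trans (kP _ _ _ c0 xy)).
have : c f <= Q ^+ size p * c (last f p).
  elim: p f fp {up Af} => [|y p IHp] x /=; first by rewrite expr0 mul1r.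
  case/andP=> xy yp; rewrite exprS -mulrA; apply: (le_trans (step _ _ xy)).
  by rewrite ler_wpM2l ?IHp // (le_trans ler01).
move/le_trans; apply; rewrite ler_wpM2r //; first exact: ltW.
rewrite ler_weXn2l //.
by apply: (leq_trans (leqnSn _)); rewrite -[X in (X <= _)%N](card_uniqP up) max_card.
Qed.

Lemma objective_update c c' k t : (forall k, 0 < c k) -> 0 < c k + t ->
  gram b c \in unitmx ->
  c' =1 (fun j => if j == k then c k + t else c j) ->
  objective c' * (1 + t / c k) ^+ usage fam k
  = objective c * (1 + t * (b k *m invmx (gram b c) *m (b k)^T) 0 0) ^+ size fam.
Proof.
move=> c0 ct cu c'E; set w := (_ *m _) 0 0.
have r0 : 1 + t / c k != 0.
  rewrite gt_eqF // -(pmulr_lgt0 _ (c0 k)) mulrDl mul1r divfK //.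
  by rewrite gt_eqF.
rewrite /objective /usage -prodrXr -big_split /=.
rewrite -(count_predT fam) -iter_mulr_1 -big_const_seq -big_split /=.
apply: eq_bigr => T _.
have -> : weight c' T = weight c T * (1 + t / c k) ^+ #|[pred i | T i == k]|.
  rewrite -prodr_const [X in _ = _ * X]big_mkcond -big_split /=.
  apply: eq_bigr => i _; rewrite c'E inE; case: eqP => [->|_]; last by rewrite mulr1.
  by rewrite mulrDr mulr1 mulrCA divff ?mulr1 // gt_eqF.
rewrite (det_gram_update cu c'E) -/w.
field; rewrite expf_neq0 // andbT.
by apply/prodf_neq0 => i _; rewrite gt_eqF.
Qed.

End Realization.

(** * Conductances with prescribed leverages *)

Lemma continuous_at_big (R : numFieldType) (X : topologicalType) (I : Type)
    (op : R -> R -> R) (idx : R) (r : seq I) (F : I -> X -> R) (x : X) :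
  continuous (fun z : R * R => op z.1 z.2) ->
  (forall i, {for x, continuous (F i)}) ->
  {for x, continuous (fun y => \big[op/idx]_(i <- r) F i y)}.
Proof.
move=> op_cont F_cont.
by apply: (@cvg_big _ _ op idx xpredT op_cont X (nbhs x) r F) => i _; apply: F_cont.
Qed.

Section Marginals.
Local Open Scope ring_scope.
Variables (R : realType) (n : nat) (K : finType) (b : K -> 'rV[R]_n).
Variable fam : seq {ffun 'I_n -> K}.
Hypothesis fam_base : forall T, T \in fam -> is_base b T.

Lemma objective_continuous (x : 'rV[R]_#|K|) : (forall i, 0 < x ord0 i) ->
  {for x, continuous (fun y : 'rV[R]_#|K| =>
     objective b fam (fun k => y ord0 (enum_rank k)))}.
Proof.
have coord i : {for x, continuous (fun y : 'rV[R]_#|K| => y ord0 i)}.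
  exact: coord_continuous.
have entry i j : {for x, continuous (fun y : 'rV[R]_#|K| =>
    gram b (fun k => y ord0 (enum_rank k)) i j)}.
  have -> : (fun y : 'rV[R]_#|K| => gram b (fun k => y ord0 (enum_rank k)) i j)
    = (fun y => \sum_k y ord0 (enum_rank k) * ((b k)^T *m b k) i j).
    by apply/funext => y; rewrite summxE; apply: eq_bigr => k _; rewrite mxE.
  apply: continuous_at_big => [|k]; first exact: add_continuous.
  by apply: continuousM; [exact: coord|exact: cst_continuous].
move=> x0; apply: continuous_at_big => [|T]; first exact: mul_continuous.
apply: continuousM; last first.
  apply: continuousV; first by apply/prodf_neq0 => i _; rewrite gt_eqF.
  by apply: continuous_at_big => [|i]; [exact: mul_continuous|exact: coord].
apply: continuous_at_big => [|s]; first exact: add_continuous.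
apply: continuousM; first exact: cst_continuous.
apply: continuous_at_big => [|i]; first exact: mul_continuous.
exact: entry.
Qed.

(** Freezing coordinates at 1 serves to remove the directions in which the
objective is constant; the box makes the domain compact. *)
Lemma objective_min (frozen : pred K) (L : R) : 1 <= L ->
  exists c : K -> R,
  [/\ forall k, L^-1 <= c k <= L, forall k, k \in frozen -> c k = 1 &
      forall c', (forall k, L^-1 <= c' k <= L) ->
        (forall k, k \in frozen -> c' k = 1) ->
      objective b fam c <= objective b fam c'].
Proof.
move=> L1; have L0 : 0 < L by apply: lt_le_trans L1.
have iL1 : L^-1 <= 1 by rewrite invf_le1.
pose A (i : 'I_#|K|) : set R :=
  if enum_val i \in frozen then [set 1]%classic else `[L^-1, L]%classic.
have AP i y : A i y -> L^-1 <= y <= L.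
  by rewrite /A; case: ifP => _ /=; [move=> ->; rewrite iL1|rewrite in_itv].
have AI c : (forall k, L^-1 <= c k <= L) -> (forall k, k \in frozen -> c k = 1) ->
    [set v : 'rV[R]_#|K| | forall i, A i (v ord0 i)]%classic (\row_i c (enum_val i)).
  move=> cL c1 i; rewrite mxE /A; case: ifP => [/c1//|_].
  by rewrite /= in_itv /= cL.
have [||//|x] := @EVT_min_rV R _ (fun y : 'rV[R]_#|K| =>
     objective b fam (fun k => y ord0 (enum_rank k)))
  [set v | forall i, A i (v ord0 i)]%classic.
- by exists (\row_i 1); apply: (AI (fun=> 1)) => // k; rewrite iL1.
- apply: (@rV_compact R) => i; rewrite /A; case: ifP => _.
    exact: compact_set1.
  exact: segment_compact.
- apply: continuous_in_subspaceT => x; rewrite inE => xA.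
  apply: objective_continuous => i; have /andP[xL _] := AP _ _ (xA i).
  by apply: lt_le_trans xL; rewrite invr_gt0.
rewrite inE => xA xmin; exists (fun k => x ord0 (enum_rank k)); split.
- by move=> k; apply: AP.
- by move=> k kF; have := xA (enum_rank k); rewrite /A /= enum_rankK kF.
move=> c' c'L c'1; have := xmin (\row_i c' (enum_val i)).
rewrite inE => /(_ (AI _ c'L c'1)) /le_trans; apply.
rewrite le_eqVlt; apply/orP; left; apply/eqP; congr objective.
by apply/funext => k; rewrite mxE enum_rankK.
Qed.

Variables (star e0 : K).
Hypothesis e0_star : e0 != star.
Hypothesis fam_star : forall T, T \in fam -> #|[pred i | T i == star]| = 1%N.
Hypothesis leverage_star : forall c, (forall k, 0 < c k) -> leverage b c star = 1.
Hypothesis fam_neq0 : fam != [::].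
Hypothesis fam_conn : forall f g, f != star -> g != star ->
  connect (exchange b fam) f g.

Lemma sum_usage : (\sum_k usage fam k = n * size fam)%N.
Proof.
rewrite /usage exchange_big /= -sum1_size big_distrr /=; apply: eq_bigr => T _.
rewrite muln1 -[RHS]card_ord -sum1_card (partition_big T xpredT) //=.
by apply: eq_bigr => k _; rewrite sum1_card.
Qed.

Lemma usage_star : usage fam star = size fam.
Proof.
rewrite /usage -sum1_size !(big_seq_cond xpredT).
by apply: eq_bigr => T /andP[Tfam _]; apply: fam_star.
Qed.

(** The objective is invariant under scaling the coefficient of [star], and under
scaling all the others together, so a minimum is sought with the coefficients
of [star] and of one further index e0 equal to 1.  By [sublevel_ratio] it lies
in the interior of a large enough box, and stationarity gives the value of all
leverages but those of [star] and e0.  The former is 1 by hypothesis, and the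
latter follows from the sum of all leverages. *)
Theorem exists_leverage_eq_usage : exists2 c : K -> R, forall k, 0 < c k &
  forall k, leverage b c k * (size fam)%:R = (usage fam k)%:R.
Proof.
have [T0 T0b] : exists T, is_base b T.
  case: fam fam_neq0 fam_base => // T s _ /(_ T) H; exists T; apply: H.
  exact: mem_head.
have [L L1 LP] := sublevel_ratio fam_base fam_conn (objective b fam (fun=> 1)).
have LL : 1 <= L + 1 by lra.
have L0 : 0 < L by lra.
have [c [cL c1 cmin]] := objective_min (pred2 star e0) LL.
have c0 k : 0 < c k.
  by have /andP[ck _] := cL k; apply: lt_le_trans ck; rewrite invr_gt0; lra.
have cu : gram b c \in unitmx.
  by apply: posdef_unitmx; have [] := gram_ge_base T0b c0.
exists c => //.
have ce0 : c e0 = 1 by apply: c1; rewrite !inE eqxx orbT.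
have leM : objective b fam c <= objective b fam (fun=> 1).
  by apply: cmin => // k; rewrite invf_le1 ?LL //; lra.
(* The minimum is interior in every direction that is not frozen. *)
have cin k : k != star -> (L + 1)^-1 < c k < L + 1.
  move=> ks; have := LP c k e0 c0 leM ks e0_star; rewrite ce0 mulr1 => ckL.
  have := LP c e0 k c0 leM e0_star ks; rewrite ce0 => ckL'.
  apply/andP; split; last by lra.
  apply: (@lt_le_trans _ _ L^-1); first by rewrite ltf_pV2 ?posrE; lra.
  by rewrite -[L^-1]mulr1 ler_pdivrMl.
have levP k : k != star -> k != e0 ->
    leverage b c k * (size fam)%:R = (usage fam k)%:R.
  move=> ks ke; have /andP[ckl ckr] := cin k ks.
  set w := (b k *m invmx (gram b c) *m (b k)^T) 0 0.
  suff wE : w * (size fam)%:R = (c k)^-1 * (usage fam k)%:R.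
    by rewrite /leverage -/w -mulrA wE mulrA divff ?mul1r // gt_eqF.
  apply: (@slope_at_contact R _ _ (Num.min (c k - (L + 1)^-1) (L + 1 - c k))).
    by rewrite lt_min !subr_gt0 ckl.
  move=> t; rewrite lt_min => /andP[t1 t2].
  pose c' j := if j == k then c k + t else c j.
  have /andP[t1' _] : - (c k - (L + 1)^-1) < t < c k - (L + 1)^-1.
    by rewrite -ltr_norml.
  have /andP[_ t2'] : - (L + 1 - c k) < t < L + 1 - c k by rewrite -ltr_norml.
  have ctl : (L + 1)^-1 < c k + t by lra.
  have ct0 : 0 < c k + t by apply: lt_trans ctl; rewrite invr_gt0; lra.
  have := @objective_update R n K b fam c c' k t c0 ct0 cu (fun=> erefl).
  rewrite -/w => E.
  have Fc : objective b fam c <= objective b fam c'.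
    apply: cmin => j; rewrite /c'.
      by case: eqP => _; [rewrite (ltW ctl) /=; lra|exact: cL].
    by case: eqP => [->|_]; [rewrite !inE (negPf ks) (negPf ke)|exact: c1].
  have F0 : 0 < objective b fam c.
    rewrite /objective big_seq; apply: prodr_gt0 => T Tfam.
    by rewrite divr_gt0 ?prodr_gt0 //; exact: det_gram_gt0 (fam_base Tfam) c0.
  rewrite -(ler_pM2l F0) -E ler_wpM2r // exprn_ge0 //.
  rewrite -(pmulr_lge0 _ (c0 k)) mulrDl mul1r divfK ?gt_eqF //.
  exact: ltW.
have levs : leverage b c star * (size fam)%:R = (usage fam star)%:R.
  by rewrite leverage_star // mul1r usage_star.
move=> k; have [->//|ks] := eqVneq k star.
have [->|ke] := eqVneq k e0; last exact: levP.
have := congr1 (fun x : nat => x%:R : R) sum_usage.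
rewrite natrM -(sum_leverage cu) mulr_suml natr_sum.
rewrite (bigD1 e0) //= [in RHS](bigD1 e0) //=.
rewrite [X in _ + X = _](eq_bigr (fun j => leverage b c j * (size fam)%:R)).
  by move/addIr.
move=> j je; have [->//|js] := eqVneq j star; by rewrite levP.
Qed.

End Marginals.

(** * Electrical networks and spanning trees *)

Lemma eq_set2l (T : finType) (x y z : T) : x != y ->
  ([set x; y] == [set x; z]) = (y == z).
Proof.
move=> xy; apply/eqP/eqP => [E|->//].
have : y \in [set x; z] by rewrite -E finset.set22.
by rewrite !inE eq_sym (negPf xy) => /eqP.
Qed.

Section Edges.
Variable G : cgraph.

Definition is_edge (e : {set G}) :=
  [exists p : G * G, adj p.1 p.2 && (e == [set p.1; p.2])].

Definition edge := {e : {set G} | is_edge e}.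

Definition edge_ends (e : edge) : G * G := xchoose (existsP (valP e)).

(** The value None, taken on pairs that are not adjacent, will index the all-ones
vector. *)
Definition edge_of (x y : G) : option edge := insub [set x; y].

Lemma edge_ofC x y : edge_of x y = edge_of y x.
Proof. by rewrite /edge_of finset.setUC. Qed.

Lemma adj_neq (x y : G) : adj x y -> x != y.
Proof. by apply: contraTneq => ->; rewrite adj_irr. Qed.

Lemma adj_edge_of (x y : G) : adj x y ->
  exists2 e : edge, edge_of x y = Some e & val e = [set x; y].
Proof.
move=> xy; have e : is_edge [set x; y].
  by apply/existsP; exists (x, y); rewrite xy eqxx.
by exists (Sub _ e); rewrite ?SubK // /edge_of insubT.
Qed.

Lemma edge_endsP (e : edge) :
  adj (edge_ends e).1 (edge_ends e).2 /\
  val e = [set (edge_ends e).1; (edge_ends e).2].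
Proof. by have /andP[-> /eqP] := xchooseP (existsP (valP e)). Qed.

Lemma edge_ends_edge_of (e : edge) :
  edge_of (edge_ends e).1 (edge_ends e).2 = Some e.
Proof. by have [_ eE] := edge_endsP e; rewrite /edge_of -eE valK. Qed.

Lemma edge_case (e : edge) : exists x y, adj x y /\ Some e = edge_of x y.
Proof.
exists (edge_ends e).1, (edge_ends e).2; rewrite edge_ends_edge_of.
by have [] := edge_endsP e.
Qed.

Lemma edge_of_inj x y z : adj x y -> adj x z -> edge_of x y = edge_of x z -> y = z.
Proof.
move=> xy xz; have [e -> eE] := adj_edge_of xy; have [f -> fE] := adj_edge_of xz.
move=> [ef]; apply/eqP; rewrite -(eq_set2l _ (adj_neq xy)) -eE -fE.
by rewrite ef.
Qed.

Lemma edge_of_neqNone x y : adj x y -> edge_of x y != None.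
Proof. by case/adj_edge_of => e ->. Qed.

Definition touches (v : G) (k : option edge) : bool :=
  if k is Some e then v \in val e else false.

Lemma touches_edge_of x y v : adj x y ->
  touches v (edge_of x y) = (v == x) || (v == y).
Proof. by move=> xy; have [e -> /= ->] := adj_edge_of xy; rewrite !inE. Qed.

End Edges.

Section Network.
Local Open Scope ring_scope.
Variables (R : realType) (G : cgraph).
Local Notation n := #|G|.
Local Notation K := (option (edge G)).
Implicit Types (phi : G -> R) (c : K -> R).

Definition drop_row (x y : G) : 'rV[R]_n :=
  \row_i ((enum_val i == x)%:R - (enum_val i == y)%:R).

(** The all-ones vector at None turns the Laplacian, whose kernel is spanned by
that vector, into an invertible matrix.  The orientation of an edge does not
matter, since only the rank-one matrix of its vector is used. *)
Definition incidence (k : K) : 'rV[R]_n :=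
  if k is Some e then drop_row (edge_ends e).1 (edge_ends e).2 else const_mx 1.

Definition potential_row phi : 'rV[R]_n := \row_i phi (enum_val i).

Lemma sum_enum_val (F : G -> R) : \sum_(i < n) F (enum_val i) = \sum_x F x.
Proof.
by rewrite [RHS](reindex (enum_val : 'I_n -> G)) //=; apply: onW_bij; apply: enum_val_bij.
Qed.

Lemma potential_row_drop phi x y :
  (potential_row phi *m (drop_row x y)^T) 0 0 = phi x - phi y.
Proof.
pose F z := phi z * ((z == x)%:R - (z == y)%:R).
rewrite mxE (eq_bigr (fun i => F (enum_val i))); last by move=> i _; rewrite !mxE.
rewrite sum_enum_val /F (eq_bigr (fun z => phi z * (z == x)%:R - phi z * (z == y)%:R)).
  have pick w : \sum_z phi z * (z == w)%:R = phi w.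
    rewrite (bigD1 w) //= eqxx mulr1 big1 ?addr0 // => z /negPf->.
    by rewrite mulr0.
  by rewrite big_split /= sumrN !pick.
by move=> z _; rewrite mulrBr.
Qed.

Lemma potential_row_const phi :
  (potential_row phi *m (incidence None)^T) 0 0 = \sum_x phi x.
Proof.
by rewrite mxE -sum_enum_val; apply: eq_bigr => i _; rewrite !mxE mulr1.
Qed.

Lemma incidence_edge_of x y : adj x y ->
  incidence (edge_of x y) = drop_row x y \/ incidence (edge_of x y) = - drop_row x y.
Proof.
move=> xy; have [e -> eE] := adj_edge_of xy; rewrite /=.
have [+ eE'] := edge_endsP e; case: (edge_ends e) eE' => s t /= eE' st.
have sxy : s \in [set x; y] by rewrite -eE [\val e]eE' finset.set21.
have txy : t \in [set x; y] by rewrite -eE [\val e]eE' finset.set22.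
have := adj_neq st; move: sxy txy; rewrite !inE.
case/orP=> /eqP-> /orP[]/eqP->; rewrite ?eqxx // => _; [by left|right].
by apply/rowP => i; rewrite !mxE opprB.
Qed.

Lemma gram_term phi c x k : k != None ->
  c k * ((potential_row phi *m (incidence k)^T) 0 0 * incidence k 0 (enum_rank x))
  = \sum_(y | adj x y) (k == edge_of x y)%:R * (c k * (phi x - phi y)).
Proof.
case: k => // e _; have [s [t [st eE]]] := edge_case e; rewrite eE.
have -> : (potential_row phi *m (incidence (edge_of s t))^T) 0 0
    * incidence (edge_of s t) 0 (enum_rank x)
   = (phi s - phi t) * ((x == s)%:R - (x == t)%:R).
  have [->|->] := incidence_edge_of st; rewrite ?linearN /=.
    by rewrite potential_row_drop mxE enum_rankK.
  by rewrite [X in X * _]mxE [X in _ * X]mxE mulrNN potential_row_drop mxE enum_rankK.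
have [->|xs] := eqVneq x s.
  rewrite (negPf (adj_neq st)) subr0 mulr1 (bigD1 t) //= eqxx mul1r big1 ?addr0 //.
  move=> y /andP[sy yt]; case: eqP => [/(edge_of_inj st sy) E|]; last by rewrite mul0r.
  by rewrite E eqxx in yt.
have [->|xt] := eqVneq x t.
  have ts : adj t s by rewrite adj_sym.
  rewrite (bigD1 s) //= edge_ofC eqxx mul1r big1 ?addr0.
    by rewrite sub0r mulrN1 opprB.
  move=> y /andP[sy yt]; case: eqP => [/(edge_of_inj ts sy) E|]; last by rewrite mul0r.
  by rewrite E eqxx in yt.
rewrite subrr !mulr0 big1 // => y xy; case: eqP => [E|]; last by rewrite mul0r.
have := touches_edge_of x xy; rewrite -E touches_edge_of // eqxx (negPf xs).
by rewrite (negPf xt).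
Qed.

(** The Gram matrix is the Laplacian plus a multiple of the all-ones matrix. *)
Lemma potential_row_gram phi c x :
  (potential_row phi *m gram incidence c) 0 (enum_rank x)
  = c None * \sum_y phi y + \sum_(y | adj x y) c (edge_of x y) * (phi x - phi y).
Proof.
rewrite mulmx_sumr summxE.
have E k : (potential_row phi *m (c k *: ((incidence k)^T *m incidence k)))
     0 (enum_rank x)
   = c k * ((potential_row phi *m (incidence k)^T) 0 0 * incidence k 0 (enum_rank x)).
  by rewrite -scalemxAr mulmxA mxE; congr (_ * _); rewrite mxE big_ord1.
rewrite (bigD1 None) //= E potential_row_const [incidence _ _ _]mxE mulr1; congr (_ + _).
under eq_bigr => k k0 do rewrite E gram_term //.
rewrite exchange_big /=; apply: eq_bigr => y xy.
rewrite (bigD1 (edge_of x y)) ?edge_of_neqNone //= eqxx mul1r big1 ?addr0 //.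
by move=> k /andP[_ /negPf->]; rewrite mul0r.
Qed.

Section Conductance.
Variable c : K -> R.
Hypothesis c0 : forall k, 0 < c k.
Hypothesis cpos : posdef (gram incidence c).
Variable v0 : G.
Local Notation P := (gram incidence c).

Let n0 : 0 < n%:R :> R.
Proof. by rewrite ltr0n; apply/card_gt0P; exists v0. Qed.

(** The value 1 on sets that are not edges is arbitrary. *)
Definition edge_conductance (s : {set G}) : R := oapp (c \o Some) 1 (insub s).

Lemma edge_conductanceE x y : adj x y ->
  edge_conductance [set x; y] = c (edge_of x y).
Proof.
move=> xy; rewrite /edge_conductance -/(edge_of x y).
by have [e ->] := adj_edge_of xy.
Qed.

Lemma ones_gram : incidence None *m P = (c None * n%:R) *: incidence None.
Proof.
have -> : incidence None = potential_row (fun=> 1) by apply/rowP => i; rewrite !mxE.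
apply/rowP => i; rewrite -(enum_valK i) potential_row_gram sumr_const !mxE mulr1.
rewrite big1 ?addr0 // => y _; by rewrite subrr mulr0.
Qed.

Lemma ones_gram_inv :
  incidence None *m invmx P = (c None * n%:R)^-1 *: incidence None.
Proof.
have cn : c None * n%:R != 0 by rewrite mulf_neq0 ?gt_eqF.
apply: (scalerI cn); rewrite scalerA divff // scale1r scalemxAl -ones_gram.
by rewrite mulmxK // posdef_unitmx.
Qed.

Lemma gram_inv_sym : (invmx P)^T = invmx P.
Proof. by case: cpos => Psym _; rewrite trmx_inv Psym. Qed.

(** The all-ones vector is an eigenvector of the Gram matrix. *)
Lemma leverage_ones : leverage incidence c None = 1.
Proof.
rewrite /leverage ones_gram_inv -scalemxAl mxE.
have -> : incidence None = potential_row (fun=> 1) by apply/rowP => i; rewrite !mxE.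
have -> : (potential_row (fun=> 1))^T = (incidence None)^T.
  by congr (_^T); apply/rowP => i; rewrite !mxE.
rewrite potential_row_const sumr_const invfM mulrA mulrA divff ?mul1r ?gt_eqF //.
by rewrite mulVf // gt_eqF.
Qed.

Lemma drop_ones x y : (drop_row x y *m (incidence None)^T) 0 0 = 0.
Proof.
have -> : drop_row x y = potential_row (fun z => (z == x)%:R - (z == y)%:R).
  by apply/rowP => i; rewrite !mxE.
rewrite potential_row_const big_split /= sumrN (bigD1 x) //= eqxx.
rewrite [X in _ - X](bigD1 y) //= eqxx !big1 ?addr0 ?subrr //.
  by move=> z /negPf->.
by move=> z /negPf->.
Qed.

Lemma unit_potentialP x y (phi : {ffun G -> R}) :
  unit_potential edge_conductance x y phi <->
  potential_row phi *m P
    = drop_row x y + (c None * \sum_z phi z) *: incidence None.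
Proof.
split=> [up|E z].
  apply/rowP => i; rewrite -(enum_valK i) potential_row_gram !mxE enum_rankK mulr1.
  rewrite addrC -up; congr (_ + _); apply: eq_bigr => z xz.
  by rewrite edge_conductanceE.
have := congr1 (fun M : 'rV[R]_n => M 0 (enum_rank z)) E.
rewrite potential_row_gram !mxE enum_rankK mulr1 => H.
apply: (addIr (c None * \sum_t phi t)); rewrite -H addrC; congr (_ + _).
by apply: eq_bigr => t zt; rewrite edge_conductanceE.
Qed.

(** A unit potential is the image of the vector of the pair under the inverse
Gram matrix, up to a constant, and constants do not affect the drop. *)
Lemma effective_resistanceE x y :
  effective_resistance edge_conductance x y
  = (drop_row x y *m invmx P *m (drop_row x y)^T) 0 0.
Proof.
have Pu := posdef_unitmx cpos.
set a := drop_row x y *m invmx P.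
have uniq (phi : {ffun G -> R}) : unit_potential edge_conductance x y phi ->
    phi x - phi y = (a *m (drop_row x y)^T) 0 0.
  move/unit_potentialP => E; rewrite -potential_row_drop -[potential_row phi](mulmxK Pu).
  rewrite E mulmxDl -scalemxAl ones_gram_inv scalerA mulmxDl -scalemxAl mxE.
  rewrite [X in _ + X]mxE -[incidence None *m _]trmxK trmx_mul trmxK [X in _ * X]mxE.
  by rewrite drop_ones mulr0 addr0.
(* Kirchhoff's law holds for this candidate because its values add up to zero. *)
pose phi0 : {ffun G -> R} := [ffun z => a 0 (enum_rank z)].
have phi0E : potential_row phi0 = a.
  by apply/rowP => i; rewrite mxE ffunE enum_valK.
have sum0 : \sum_z phi0 z = 0.
  rewrite -potential_row_const phi0E /a -mulmxA.
  have -> : invmx P *m (incidence None)^T = (incidence None *m invmx P)^T.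
    by rewrite trmx_mul gram_inv_sym.
  by rewrite ones_gram_inv linearZ /= -scalemxAr mxE drop_ones mulr0.
apply: uniq; apply: (@xgetPex _ 0 [set phi | unit_potential edge_conductance x y phi]%classic).
exists phi0; apply/unit_potentialP.
by rewrite sum0 mulr0 scale0r addr0 phi0E mulmxKV.
Qed.

Lemma relative_resistanceE x y : adj x y ->
  relative_resistance edge_conductance x y = leverage incidence c (edge_of x y).
Proof.
move=> xy; rewrite /relative_resistance /leverage edge_conductanceE //.
rewrite effective_resistanceE; congr (_ * _).
have [->//|->] := incidence_edge_of xy.
by rewrite linearN /= mulmxN !mulNmx opprK.
Qed.

End Conductance.

(** A vector orthogonal to the tree edges is constant, and one orthogonal to the
all-ones vector has zero sum. *)
Lemma is_base_connected (T : {ffun 'I_n -> K}) :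
  (exists i, T i = None) ->
  (forall phi, (forall i x y, adj x y -> T i = edge_of x y -> phi x = phi y) ->
    forall x y, phi x = phi y) ->
  is_base incidence T.
Proof.
move=> [i0 Ti0] Tconn; rewrite /is_base -det_tr; apply/det0P => -[v v0 vT].
pose phi z := v 0 (enum_rank z).
have vE : v = potential_row phi.
  by apply/rowP => i; rewrite mxE /phi enum_valK.
have vTi i : (v *m (incidence (T i))^T) 0 0 = 0.
  have := congr1 (fun M : 'rV[R]_n => M 0 i) vT.
  rewrite [X in _ = X -> _]mxE => H; rewrite -[RHS]H !mxE.
  by apply: eq_bigr => j _; rewrite !mxE.
have phic x y : phi x = phi y.
  apply: Tconn => i z t zt Ti; have := vTi i; rewrite Ti vE => H.
  have : (potential_row phi *m (drop_row z t)^T) 0 0 = 0.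
    have [E|E] := incidence_edge_of zt; rewrite E in H => //.
    by move: H; rewrite linearN /= mulmxN [X in X = _ -> _]mxE => /eqP; rewrite oppr_eq0 => /eqP.
  by rewrite potential_row_drop => /eqP; rewrite subr_eq0 => /eqP.
have := vTi i0; rewrite Ti0 vE potential_row_const => s0.
case/negP: v0; apply/eqP/rowP => i; rewrite vE !mxE.
move: s0; rewrite (eq_bigr (fun=> phi (enum_val i))) // sumr_const -mulr_natr.
move/eqP; rewrite mulf_eq0 pnatr_eq0 => /orP[/eqP//|/eqP/card0_eq/(_ (enum_val i))].
by rewrite inE.
Qed.

Definition tree_degree (T : {ffun 'I_n -> K}) (v : G) := #|[pred i | touches v (T i)]|.

Lemma tree_degreeE (T : {ffun 'I_n -> K}) v :
  tree_degree T v = (\sum_i touches v (T i))%N.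
Proof.
rewrite -[LHS](sum1_card [pred i | touches v (T i)]) big_mkcond.
by apply: eq_bigr => i _; rewrite inE; case: (touches v (T i)).
Qed.

Lemma sum_usage_degree (fam : seq {ffun 'I_n -> K}) v :
  (\sum_(u | adj u v) usage fam (edge_of u v)
   <= \sum_(T <- fam) tree_degree T v)%N.
Proof.
rewrite /usage exchange_big /=; apply: leq_sum => T _.
rewrite tree_degreeE.
rewrite (eq_bigr (fun u => \sum_i (T i == edge_of u v : nat))%N); last first.
  move=> u _; rewrite -[LHS](sum1_card [pred i | T i == edge_of u v]) big_mkcond.
  by apply: eq_bigr => i _; rewrite inE; case: eqP.
rewrite exchange_big /=.
apply: leq_sum => i _.
have [u /andP[uv /eqP Ti]|none] := pickP (fun u => adj u v && (T i == edge_of u v)).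
  rewrite Ti touches_edge_of // eqxx orbT (bigD1 u) //= eqxx big1 // => w /andP[wv wu].
  case: eqP => // E; have vw : adj v w by rewrite adj_sym.
  have vu : adj v u by rewrite adj_sym.
  rewrite edge_ofC [RHS]edge_ofC in E.
  by rewrite (edge_of_inj vu vw E) eqxx in wu.
rewrite big1 // => u uv; case: eqP => // E.
by have := none u; rewrite uv E eqxx.
Qed.

(** With the conductances of [exists_leverage_eq_usage] the relative resistances at
a vertex add up to its average degree in the family. *)
Theorem resistance_nonnegative_trees (fam : seq {ffun 'I_n -> K}) (x0 y0 : G) :
  adj x0 y0 -> fam != [::] ->
  (forall T, T \in fam -> is_base incidence T) ->
  (forall T, T \in fam -> #|[pred i | T i == None]| = 1%N) ->
  (forall f g, f != None -> g != None -> connect (exchange incidence fam) f g) ->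
  (forall v, (\sum_(T <- fam) tree_degree T v <= 2 * size fam)%N) ->
  resistance_nonnegative R G.
Proof.
move=> xy0 fam0 fam_base fam_star fam_conn fam_deg.
have [T0 T0fam] : exists T, T \in fam.
  by case: (fam) fam0 => // T s _; exists T; rewrite mem_head.
have pos c : (forall k, 0 < c k) -> posdef (gram incidence c).
  by move=> c0; have [] := gram_ge_base (fam_base _ T0fam) c0.
have lev c (c0 : forall k, 0 < c k) : leverage incidence c None = 1.
  by apply: leverage_ones => //; apply: pos.
have [c c0 cE] := exists_leverage_eq_usage fam_base (edge_of_neqNone xy0) fam_star lev fam0 fam_conn.
exists (edge_conductance c); split=> [x y xy|v].
  by rewrite edge_conductanceE.
rewrite /resistance_curvature subr_ge0 ler_pdivrMl ?ltr0n // mulr1.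
have s0 : 0 < (size fam)%:R :> R by rewrite ltr0n lt0n size_eq0.
rewrite -(ler_pM2r s0) mulr_suml -natrM.
rewrite (eq_bigr (fun u => (usage fam (edge_of u v))%:R)); last first.
  by move=> u uv; rewrite relative_resistanceE ?cE //; apply: pos.
rewrite -natr_sum ler_nat; apply: leq_trans (fam_deg v).
exact: sum_usage_degree.
Qed.

End Network.

(** * Exchanges along Hamiltonian paths *)

Definition graph_order (G : cgraph) : nat := #|G|.

Section HamiltonPaths.
Variables (R : realType) (G : cgraph).
Local Notation n := (graph_order G).
Local Notation K := (option (edge G)).
Local Notation is_base := (is_base (incidence R (G := G))).
Local Notation exchange := (exchange (incidence R (G := G))).
Local Notation tree := {ffun 'I_n -> K}.

Definition hamiltonian_path (s : nat -> G) :=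
  (forall k, k.+1 < n -> adj (s k) (s k.+1)) /\
  (forall x, exists2 k, k < n & s k = x).

(** The last index, which no edge of the path claims, carries the all-ones vector. *)
Definition path_tree (s : nat -> G) : tree :=
  [ffun i : 'I_n => if i.+1 < n then edge_of (s i) (s i.+1) else None].

(** A surjection between finite sets of the same cardinality is injective. *)
Lemma hamiltonian_path_inj s : hamiltonian_path s ->
  forall i j, i < n -> j < n -> s i = s j -> i = j.
Proof.
case=> _ s_onto i j lin ljn sij.
pose t (k : 'I_n) := s k.
have t_onto x : x \in codom t.
  by have [k lkn <-] := s_onto x; apply/codomP; exists (Ordinal lkn).
have t_inj : injective t.
  apply/injectiveP/card_uniqP; rewrite size_codom card_ord.
  by apply: eq_card => x; rewrite t_onto.
by have [] := t_inj (Ordinal lin) (Ordinal ljn) sij.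
Qed.

Section OnePath.
Variable s : nat -> G.
Hypothesis s_ham : hamiltonian_path s.

Let s_adj k : k.+1 < n -> adj (s k) (s k.+1).
Proof. by case: s_ham => H _; apply: H. Qed.

Let s_inj := hamiltonian_path_inj s_ham.

Lemma path_treeE (i : 'I_n) : i.+1 < n -> path_tree s i = edge_of (s i) (s i.+1).
Proof. by rewrite ffunE => ->. Qed.

Lemma path_tree_star : #|[pred i | path_tree s i == None]| = 1.
Proof.
have n0 : 0 < n by apply/card_gt0P; exists (s 0).
have ln : n.-1 < n by lia.
rewrite -(card1 (Ordinal ln)); apply: eq_card => i.
rewrite !inE ffunE -val_eqE /=; case: ifP => [lt_in|].
  by rewrite (negPf (edge_of_neqNone (s_adj lt_in))); lia.
rewrite eqxx; have := ltn_ord i => lin /negbT nlin.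
by apply/esym/eqP; lia.
Qed.

Lemma path_tree_base : is_base (path_tree s).
Proof.
apply: is_base_connected => [|phi phiT].
  by have /card_gt0P[i] : 0 < #|[pred i | path_tree s i == None]|
    by [rewrite path_tree_star]; rewrite inE => /eqP; exists i.
suff phi0 k : k < n -> phi (s k) = phi (s 0).
  by case: s_ham => _ s_onto x y; have [i lin <-] := s_onto x;
     have [j ljn <-] := s_onto y; rewrite !phi0.
elim: k => // k IHk lkn; rewrite -IHk; last by lia.
have lk : k < n by lia.
by apply/esym/(phiT (Ordinal lk)); rewrite ?s_adj ?path_treeE.
Qed.

(** Deleting the edge at i cuts the path into an initial and a final segment,
which the chord joins again. *)
Lemma chord_base (i : 'I_n) a b : a <= i < b -> b < n -> adj (s a) (s b) ->
  is_base (substitute (path_tree s) i (edge_of (s a) (s b))).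
Proof.
move=> /andP[le_ai lt_ib] lt_bn ab; apply: is_base_connected => [|phi phiT].
  have /card_gt0P[j] : 0 < #|[pred i | path_tree s i == None]|
    by [rewrite path_tree_star].
  rewrite inE => /eqP Tj; exists j; rewrite ffunE; case: eqP => // ji.
  have li : i.+1 < n by lia.
  by have := edge_of_neqNone (s_adj li); rewrite -path_treeE // -ji Tj.
have step k : k.+1 < n -> k != i -> phi (s k) = phi (s k.+1).
  move=> lkn ki; have lk : k < n by lia.
  apply: (phiT (Ordinal lk)); first exact: s_adj.
  by rewrite ffunE path_treeE // -val_eqE /= (negPf ki).
have lo k : k <= i -> phi (s k) = phi (s 0).
  elim: k => // k IHk lki; rewrite -IHk; last by lia.
  by rewrite -step //; lia.
have hi k : i < k -> k < n -> phi (s k) = phi (s b).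
  suff H m : i < m -> m < n -> phi (s m) = phi (s i.+1).
    by move=> ik kn; rewrite !H.
  elim: m => // m IHm lim lmn.
  have [->//|mi] := eqVneq m i.
  by rewrite -step // IHm //; lia.
have link : phi (s a) = phi (s b) by apply: (phiT i) => //; rewrite ffunE eqxx.
suff phi0 k : k < n -> phi (s k) = phi (s 0).
  by case: s_ham => _ s_onto x y; have [p lp <-] := s_onto x;
     have [q lq <-] := s_onto y; rewrite !phi0.
move=> lkn; case: (leqP k i) => [/lo//|lik].
by rewrite hi // -link lo.
Qed.

Lemma path_tree_degree v : tree_degree (path_tree s) v <= 2.
Proof.
case: s_ham => _ /(_ v)[p lpn <-]; have lp : p.-1 < n by lia.
apply: leq_trans (_ : #|pred2 (Ordinal lpn) (Ordinal lp)| <= 2); last first.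
  by rewrite card2; lia.
apply: subset_leq_card; apply/fintype.subsetP => i; rewrite !inE ffunE.
case: ifP => // lin; rewrite touches_edge_of ?s_adj // -!val_eqE /=.
by case/orP=> /eqP /s_inj E; have := E lpn; have := ltn_ord i; lia.
Qed.

Lemma path_tree_degree_end : tree_degree (path_tree s) (s 0) <= 1.
Proof.
have n0 : 0 < n by apply/card_gt0P; exists (s 0).
rewrite -(card1 (Ordinal n0)).
apply: subset_leq_card; apply/fintype.subsetP => i; rewrite !inE ffunE.
case: ifP => // lin; rewrite touches_edge_of ?s_adj // -!val_eqE /=.
by case/orP=> /eqP /s_inj E; have := E n0; have := ltn_ord i; lia.
Qed.

End OnePath.

Lemma substitute_degree (T : tree) i f v :
  tree_degree (substitute T i f) v + touches v (T i)
  = tree_degree T v + touches v f.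
Proof.
rewrite !tree_degreeE (bigD1 i) //= [in RHS](bigD1 i) //= ffunE eqxx.
rewrite (eq_bigr (fun j => touches v (T j) : nat)) => [|j ji].
  by rewrite addnAC [RHS]addnAC [X in X + _ = _]addnC.
by rewrite ffunE (negPf ji).
Qed.

Lemma substituteK (T : tree) i f : substitute (substitute T i f) i (T i) = T.
Proof. by apply/ffunP => j; rewrite !ffunE; case: eqP => // ->. Qed.

Definition is_tree (T : tree) :=
  is_base T && (#|[pred i | T i == None]| == 1).

Definition admissible (fam : seq tree) :=
  all is_tree fam /\
  forall v, \sum_(T <- fam) tree_degree T v <= 2 * size fam.

(** Slack at v pays for one more tree in which v has degree 3. *)
Definition slack (v : G) := exists2 fam, admissible fam &
  \sum_(T <- fam) tree_degree T v < 2 * size fam.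

Definition exchangeable (f g : K) := exists2 fam, admissible fam & exchange fam f g.

Lemma admissible_cat fam1 fam2 :
  admissible fam1 -> admissible fam2 -> admissible (fam1 ++ fam2).
Proof.
move=> [t1 d1] [t2 d2]; split=> [|v]; first by rewrite all_cat t1.
by rewrite big_cat size_cat mulnDr leq_add ?d1 ?d2.
Qed.

Lemma exchange_cat fam1 fam2 f g :
  exchange (fam1 ++ fam2) f g = exchange fam1 f g || exchange fam2 f g.
Proof. exact: has_cat. Qed.

Lemma path_admissible s : hamiltonian_path s -> admissible [:: path_tree s].
Proof.
move=> s_ham; split=> [|v]; last by rewrite big_seq1 muln1 path_tree_degree.
by rewrite /= /is_tree path_tree_base // path_tree_star.
Qed.

Lemma slack_end s : hamiltonian_path s -> slack (s 0).
Proof.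
move=> s_ham; exists [:: path_tree s]; first exact: path_admissible.
by rewrite big_seq1 /=; have := path_tree_degree_end s_ham; lia.
Qed.

Lemma exchange_chord s a k b : hamiltonian_path s -> a <= k < b -> b < n ->
  adj (s a) (s b) ->
  exchangeable (edge_of (s a) (s b)) (edge_of (s k) (s k.+1)).
Proof.
move=> s_ham akb bn ab; exists [:: path_tree s]; first exact: path_admissible.
have lk : k < n by lia.
rewrite /= orbF; apply/existsP; exists (Ordinal lk).
by rewrite path_treeE ?eqxx ?chord_base //=; lia.
Qed.

(** Replacing the tree edge yz by xy leaves the degree of y unchanged, raises that
of x and lowers that of z.  The slack of x absorbs the former, and the result
has slack at z.  The reverse exchange restores the path, whence the second
conclusion. *)
Lemma slack_rotate s (i : 'I_n) x y z : hamiltonian_path s ->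
  adj x y -> adj y z -> path_tree s i = edge_of y z ->
  is_base (substitute (path_tree s) i (edge_of x y)) ->
  slack x -> slack z /\ exchangeable (edge_of y z) (edge_of x y).
Proof.
move=> s_ham xy yz Ti Tb [fam fam_ok fam_x].
set T' := substitute _ _ _ in Tb.
have T'deg v := substitute_degree (path_tree s) i (edge_of x y) v.
have T'star : is_tree T'.
  rewrite /is_tree Tb /= -(path_tree_star s_ham); apply/eqP/eq_card => j.
  rewrite !inE ffunE; case: (eqVneq j i) => // ->.
  by rewrite Ti !(negPf (edge_of_neqNone _)).
have fam'_ok : admissible (rcons fam T').
  case: fam_ok => fam_tree fam_deg; split=> [|v].
    by rewrite all_rcons T'star.
  rewrite -cats1 big_cat big_seq1 size_cat /=.
  have := T'deg v; have := path_tree_degree s_ham v; have := fam_deg v.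
  rewrite Ti !touches_edge_of // -/T'.
  case: (eqVneq v x) => [->|_]; last by lia.
  by have := fam_x; lia.
split.
  have [<-|xz] := eqVneq x z; first by exists fam.
  exists (rcons fam T') => //; case: fam_ok => _ /(_ z).
  rewrite -cats1 big_cat big_seq1 size_cat /=.
  have := T'deg z; have := path_tree_degree s_ham z.
  rewrite Ti !touches_edge_of // -/T' eqxx orbT (eq_sym z x) (negPf xz).
  by have := adj_neq yz; rewrite eq_sym => /negPf->; lia.
exists (rcons fam T') => //; apply/hasP; exists T'.
  by rewrite mem_rcons mem_head.
apply/existsP; exists i; rewrite -Ti substituteK path_tree_base // andbT.
by rewrite ffunE eqxx.
Qed.

(** The two instances of [slack_rotate] in which the deleted edge is the one at an
end of the chord that points towards the other end. *)
Lemma slack_chord s a b : hamiltonian_path s -> a < b < n -> adj (s a) (s b) ->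
  (slack (s a) -> slack (s b.-1) /\
     exchangeable (edge_of (s b.-1) (s b)) (edge_of (s a) (s b))) /\
  (slack (s b) -> slack (s a.+1) /\
     exchangeable (edge_of (s a) (s a.+1)) (edge_of (s a) (s b))).
Proof.
move=> s_ham /andP[ab bn] sab; have [s_adj _] := s_ham.
have la : a < n by lia.
have lb : b.-1 < n by lia.
have bE : b.-1.+1 = b by lia.
split.
  rewrite (edge_ofC (s b.-1)).
  apply: (@slack_rotate s (Ordinal lb)) => //.
  - by rewrite adj_sym -{2}bE s_adj // bE.
  - by rewrite path_treeE /= bE // edge_ofC.
  - by apply: chord_base => //=; lia.
rewrite (edge_ofC (s a) (s b)).
apply: (@slack_rotate s (Ordinal la)) => //.
- by rewrite adj_sym.
- by apply: s_adj; lia.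
- by rewrite path_treeE //=; lia.
- by rewrite edge_ofC; apply: chord_base => //=; lia.
Qed.

Lemma exchangeable_family (s : seq (K * K)) :
  (forall p, p \in s -> exchangeable p.1 p.2) ->
  exists2 fam, admissible fam & forall p, p \in s -> exchange fam p.1 p.2.
Proof.
elim: s => [|p s IHs] ex.
  by exists [::] => [|p]; [split=> // v; rewrite big_nil|rewrite in_nil].
have [|fam1 ok1 ex1] := IHs; first by move=> q qs; apply: ex; rewrite inE qs orbT.
have [fam2 ok2 ex2] := ex p (mem_head _ _).
exists (fam2 ++ fam1) => [|q]; first exact: admissible_cat.
by rewrite inE exchange_cat => /orP[/eqP->|/ex1->]; rewrite ?ex2 ?orbT.
Qed.

(** Admissible families can be concatenated, so a single one realizes all possible
exchanges. *)
Theorem resistance_nonnegative_exchangeable s : hamiltonian_path s -> 1 < n ->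
  (forall S : K -> Prop, (forall f g, S f -> exchangeable f g -> S g) ->
    forall f g, f != None -> g != None -> S f -> S g) ->
  resistance_nonnegative R G.
Proof.
move=> s_ham n1 closedT.
have [|fam0 ok0 ex0] := @exchangeable_family
  [seq p <- enum {: K * K} | `[< exchangeable p.1 p.2 >]].
  by move=> p; rewrite mem_filter => /andP[/asboolP].
have [ok0t ok0d] := admissible_cat (path_admissible s_ham) ok0.
have s01 : adj (s 0) (s 1) by case: s_ham => s_adj _; apply: s_adj.
apply: (@resistance_nonnegative_trees R G (path_tree s :: fam0) _ _ s01) => //.
- by move=> T /(allP ok0t)/andP[].
- by move=> T /(allP ok0t)/andP[_ /eqP].
move=> f g f0 g0.
apply: (closedT (fun h => connect (exchange (path_tree s :: fam0)) f h) _ f g) => //.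
move=> h k fh hk; apply: connect_trans fh _; apply: connect1.
rewrite -cat1s exchange_cat; apply/orP; right.
by apply: (ex0 (h, k)); rewrite mem_filter mem_enum andbT; apply/asboolP.
Qed.

End HamiltonPaths.

(** * Boustrophedon paths in a spanning grid *)

Section Snakes.
Variable X : Type.
Implicit Types e : X -> X -> Prop.

Definition line e L (s : nat -> X) :=
  forall k, k.+1 < L -> e (s k) (s k.+1).

Definition grid e N M (g : nat -> nat -> X) :=
  (forall i j, i.+1 < N -> j < M -> e (g i j) (g i.+1 j)) /\
  (forall i j, i < N -> j.+1 < M -> e (g i j) (g i j.+1)).

(** Column reached after j steps in row i; rows run alternately in both
directions, and b selects one of the two mirror images. *)
Definition turn (b : bool) i M j := if odd i (+) b then M.-1 - j else j.

Definition snake (b : bool) M (g : nat -> nat -> X) (k : nat) : X :=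
  g (k %/ M) (turn b (k %/ M) M (k %% M)).

Definition snake_pos (b : bool) M i j := i * M + turn b i M j.

Lemma turn_lt b i M j : j < M -> turn b i M j < M.
Proof. by move=> jM; rewrite /turn; case: ifP => _; lia. Qed.

Lemma turnK b i M j : j < M -> turn b i M (turn b i M j) = j.
Proof. by move=> jM; rewrite /turn; case: (odd i (+) b) => /=; lia. Qed.

Lemma snake_pos_lt b N M i j : i < N -> j < M -> snake_pos b M i j < N * M.
Proof.
move=> iN jM; have := turn_lt b i jM; rewrite /snake_pos.
have : i.+1 * M <= N * M by rewrite leq_mul2r iN orbT.
by rewrite mulSn; lia.
Qed.

Lemma snakeE b M g i j : j < M -> snake b M g (snake_pos b M i j) = g i j.
Proof.
move=> jM; have tM := turn_lt b i jM; have M0 : 0 < M by lia.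
rewrite /snake /snake_pos divnMDl // divn_small // addn0.
by rewrite modnMDl modn_small // turnK.
Qed.

Lemma snake_posP b N M k : k < N * M ->
  exists i j, [/\ i < N, j < M & k = snake_pos b M i j].
Proof.
move=> kNM; have M0 : 0 < M by case: M kNM => //; rewrite muln0.
have km := ltn_pmod k M0.
exists (k %/ M), (turn b (k %/ M) M (k %% M)); split.
- by rewrite ltn_divLR.
- exact: turn_lt.
- by rewrite /snake_pos turnK // -divn_eq.
Qed.

Lemma snake_line e b N M g : (forall x y, e x y -> e y x) ->
  grid e N M g -> line e (N * M) (snake b M g).
Proof.
move=> esym [vert horiz] k kNM.
have k1 : k < N * M by lia.
have [i [j [iN jM kE]]] := snake_posP b k1; rewrite {1}kE snakeE //.
have [fwd|bwd] := boolP (odd i (+) b).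
- have [j0|j0] := posnP j.
    have kE' : k.+1 = i.+1 * M by rewrite kE /snake_pos /turn fwd mulSn j0; lia.
    have iN' : i.+1 < N by move: kNM; rewrite kE' ltn_mul2r => /andP[].
    have -> : k.+1 = snake_pos b M i.+1 0.
      by rewrite kE /snake_pos /turn fwd /= addNb fwd mulSn j0 /=; lia.
    by rewrite snakeE ?j0; [apply: vert; lia|lia].
  have -> : k.+1 = snake_pos b M i j.-1.
    by rewrite kE /snake_pos /turn fwd; lia.
  rewrite snakeE; last by lia.
  by apply: esym; rewrite -{2}(prednK j0); apply: horiz; lia.
- have [jl|jl] := ltnP j.+1 M.
    have -> : k.+1 = snake_pos b M i j.+1.
      by rewrite kE /snake_pos /turn (negPf bwd); lia.
    by rewrite snakeE //; apply: horiz.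
  have jE : j = M.-1 by lia.
  have kE' : k.+1 = i.+1 * M.
    by rewrite kE /snake_pos /turn (negPf bwd) mulSn jE; lia.
  have iN' : i.+1 < N by move: kNM; rewrite kE' ltn_mul2r => /andP[].
  have -> : k.+1 = snake_pos b M i.+1 j.
    by rewrite kE /snake_pos /turn (negPf bwd) /= addNb (negPf bwd) mulSn jE /=; lia.
  by rewrite snakeE //; apply: vert.
Qed.

Lemma grid_transpose e N M g : grid e N M g -> grid e M N (fun i j => g j i).
Proof. by case=> vert horiz; split=> i j iM jN; [apply: horiz|apply: vert]. Qed.

End Snakes.

Section GridGraph.
Variables (R : realType) (G : cgraph).
Local Notation n := (graph_order G).
Local Notation K := (option (edge G)).
Local Notation exchangeable := (@exchangeable R G).

Definition spanning_grid N M (g : nat -> nat -> G) :=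
  [/\ grid (fun x y : G => adj x y) N M g, N * M = n &
      forall x, exists i j, [/\ i < N, j < M & g i j = x]].

Lemma spanning_grid_transpose N M g :
  spanning_grid N M g -> spanning_grid M N (fun i j => g j i).
Proof.
case=> gg NM g_onto; split; first exact: grid_transpose.
  by rewrite mulnC.
by move=> x; have [i [j [iN jM E]]] := g_onto x; exists j, i.
Qed.

Lemma snake_hamiltonian N M g b : spanning_grid N M g ->
  hamiltonian_path (snake b M g).
Proof.
case=> gg NM g_onto; split=> [k|x].
  by rewrite -NM; apply: snake_line gg k => x y; rewrite adj_sym.
have [i [j [iN jM <-]]] := g_onto x.
by exists (snake_pos b M i j); rewrite ?snakeE // -NM snake_pos_lt.
Qed.

(** Between the two ends of a vertical chord the path runs through all cells of the
two rows that lie on one side of the chord.  The mirror image of the path is used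
for the other side. *)
Lemma vertical_exchange N M g (S : K -> Prop) i j :
  spanning_grid N M g -> (forall f h, S f -> exchangeable f h -> S h) ->
  i.+1 < N -> j < M -> S (edge_of (g i j) (g i.+1 j)) ->
  forall j', j'.+1 < M ->
    S (edge_of (g i j') (g i j'.+1)) /\ S (edge_of (g i.+1 j') (g i.+1 j'.+1)).
Proof.
move=> gg S_closed iN jM Sij j' jM'.
have [[vert _] NM _] := gg; have vij := vert i j iN jM.
have j'M : j' < M by lia.
have chord b k : snake_pos b M i j <= k < snake_pos b M i.+1 j ->
    S (edge_of (snake b M g k) (snake b M g k.+1)).
  move=> kP; apply: (S_closed _ _ Sij).
  have := @exchange_chord R G _ _ k _ (snake_hamiltonian b gg) kP.
  by rewrite !snakeE //; apply => //; rewrite -NM snake_pos_lt.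
have [le_jj'|lt_j'j] := leqP j j'; last first.
- pose b := ~~ odd i.
  have E1 : snake_pos b M i j' = (snake_pos b M i j'.+1).+1.
    by rewrite /snake_pos /turn /b addbN addbb /=; lia.
  have E2 : snake_pos b M i.+1 j'.+1 = (snake_pos b M i.+1 j').+1.
    by rewrite /snake_pos /turn /b /= addbb /=; lia.
  split.
    have := chord b (snake_pos b M i j'.+1); rewrite -E1 !snakeE // edge_ofC.
    apply; rewrite /snake_pos /turn /b addbN addbb /= addbb mulSn /=; lia.
  have := chord b (snake_pos b M i.+1 j'); rewrite -E2 !snakeE //.
  apply; rewrite /snake_pos /turn /b addbN addbb /= addbb mulSn /=; lia.
- pose b := odd i.
  have E1 : snake_pos b M i j'.+1 = (snake_pos b M i j').+1.
    by rewrite /snake_pos /turn /b addbb /=; lia.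
  have E2 : snake_pos b M i.+1 j' = (snake_pos b M i.+1 j'.+1).+1.
    by rewrite /snake_pos /turn /b /= addNb addbb /=; lia.
  split.
    have := chord b (snake_pos b M i j'); rewrite -E1 !snakeE //.
    apply; rewrite /snake_pos /turn /b /= addNb addbb mulSn /=; lia.
  have := chord b (snake_pos b M i.+1 j'.+1); rewrite -E2 !snakeE // edge_ofC.
  apply; rewrite /snake_pos /turn /b /= addNb addbb mulSn /=; lia.
Qed.

(** One vertical edge gives a full row of horizontal edges; by transposition these
give all vertical edges, which give all horizontal ones. *)
Lemma grid_exchange N M g (S : K -> Prop) :
  spanning_grid N M g -> 1 < N -> 1 < M ->
  (forall f h, S f -> exchangeable f h -> S h) ->
  (exists i j, [/\ i.+1 < N, j < M & S (edge_of (g i j) (g i.+1 j))]) ->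
  grid (fun x y => S (edge_of x y)) N M g.
Proof.
move=> gg N1 M1 S_closed [i [j [iN jM Sij]]].
have gT := spanning_grid_transpose gg.
have H0 j' : j'.+1 < M -> S (edge_of (g i j') (g i j'.+1)).
  by move=> j'M; case: (vertical_exchange gg S_closed iN jM Sij j'M).
have V i' j' : i'.+1 < N -> j' < M -> S (edge_of (g i' j') (g i'.+1 j')).
  move=> iN' jM'; have iN0 : i < N by lia.
  have [jl|jl] := ltnP j'.+1 M.
    by case: (vertical_exchange gT S_closed jl iN0 (H0 _ jl) iN').
  case: j' jM' jl => [|j'] jM' jl; first by lia.
  by case: (vertical_exchange gT S_closed jM' iN0 (H0 _ jM') iN').
split=> // i' j' iN' jM'; have M0 : 0 < M by lia.
have [il|il] := ltnP i'.+1 N.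
  by case: (vertical_exchange gg S_closed il M0 (V _ _ il M0) jM').
case: i' iN' il => [|i'] iN' il; first by lia.
by case: (vertical_exchange gg S_closed iN' M0 (V _ _ iN' M0) jM').
Qed.

(** These are rotations along the row paths, with a vertical side of the square as
chord: in one mirror image the path leaves the left side through the square, in
the other one the right side. *)
Lemma slack_square N M g i j : spanning_grid N M g -> i.+1 < N -> j.+1 < M ->
  [/\ slack R (g i j) -> slack R (g i.+1 j.+1),
      slack R (g i.+1 j) -> slack R (g i j.+1) &
      slack R (g i j.+1) -> slack R (g i.+1 j)].
Proof.
move=> gg iN jM; have [[vert _] NM _] := gg.
have j'M : j < M by lia.
have chord b l : l < M -> (slack R (g i l) ->
     slack R (snake b M g (snake_pos b M i.+1 l).-1)) /\
   (slack R (g i.+1 l) -> slack R (snake b M g (snake_pos b M i l).+1)).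
  move=> lM; have ab : snake_pos b M i l < snake_pos b M i.+1 l < n.
    rewrite -NM snake_pos_lt // andbT /snake_pos mulSn.
    by rewrite -addnA addnCA ltn_add2l; have := turn_lt b i lM; lia.
  have := @slack_chord R G _ _ _ (snake_hamiltonian b gg) ab.
  rewrite !snakeE // => /(_ (vert _ _ iN lM)) [c1 c2].
  by split=> [/c1[]|/c2[]].
have := chord (odd i) j j'M; have := chord (~~ odd i) j.+1 jM.
have E1 : snake_pos (odd i) M i j.+1 = (snake_pos (odd i) M i j).+1.
  by rewrite /snake_pos /turn addbb /=; lia.
have E2 : (snake_pos (odd i) M i.+1 j).-1 = snake_pos (odd i) M i.+1 j.+1.
  by rewrite /snake_pos /turn /= addNb addbb /=; lia.
have E3 : (snake_pos (~~ odd i) M i.+1 j.+1).-1 = snake_pos (~~ odd i) M i.+1 j.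
  by rewrite /snake_pos /turn /= addbb /=; lia.
by rewrite -E1 E2 E3 !snakeE // => -[c1 _] [c3 c4].
Qed.

(** Slack spreads from the corner: along row 0 by zigzag through row 1, then
downwards. *)
Lemma slack_even N M g i j : spanning_grid N M g -> 1 < N -> 1 < M ->
  i < N -> j < M -> ~~ odd (i + j) -> slack R (g i j).
Proof.
move=> gg N1 M1.
have s00 : slack R (g 0 0).
  have <- : snake false M g 0 = g 0 0 by rewrite /snake div0n mod0n.
  exact: slack_end (snake_hamiltonian false gg).
have row0 k : k.*2 < M -> slack R (g 0 k.*2).
  elim: k => [//|k IHk]; rewrite doubleS => kM.
  have [k1 k2] : k.*2.+1 < M /\ k.*2 < M by lia.
  have [down _ _] := slack_square gg N1 k1.
  have [_ up _] := slack_square gg N1 kM.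
  exact/up/down/IHk.
elim: i j => [|i IHi] j iN jM; rewrite ?add0n => even_j.
  by rewrite -(even_halfK even_j); apply: row0; rewrite even_halfK.
have iN' : i < N by lia.
case: j jM even_j => [|j] jM even_ij.
  have [_ _ H] := slack_square gg iN M1.
  by apply/H/IHi => //; rewrite addn1; rewrite addn0 in even_ij.
have [H _ _] := slack_square gg iN jM; apply/H/IHi => //; first by lia.
by move: even_ij; rewrite addSn addnS /= negbK.
Qed.

(** Every edge is a chord of the row path, hence leads to a grid edge, and by
[grid_exchange] to all of them.  The end of the edge that has the colour of the
corner has slack, so that [slack_chord] leads from a grid edge back to it. *)
Theorem resistance_nonnegative_grid N M g (colour : G -> bool) :
  spanning_grid N M g -> 1 < N -> 1 < M ->
  (forall x y, adj x y -> colour x != colour y) ->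
  resistance_nonnegative R G.
Proof.
move=> gg N1 M1 bip; have [gadj NM g_onto] := gg; have [vert horiz] := gadj.
pose s := snake false M g; have s_ham : hamiltonian_path s := snake_hamiltonian false gg.
have [s_adj s_onto] := s_ham; have s_inj := hamiltonian_path_inj s_ham.
have n1 : 1 < n by rewrite -NM; have := leq_mul N1 M1; lia.
apply: (resistance_nonnegative_exchangeable s_ham n1) => S S_closed f h.
have colourE i j : i < N -> j < M -> colour (g i j) = odd (i + j) (+) colour (g 0 0).
  have row j' : j' < M -> colour (g 0 j') = odd j' (+) colour (g 0 0).
    elim: j' => [|j' IHj] j'M; first by rewrite addFb.
    have j'M' : j' < M by lia.
    have := bip _ _ (horiz 0 j' (ltnW N1) j'M); rewrite IHj //=.
    by case: (colour _); case: (colour _); case: (odd _).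
  elim: i => [|i IHi] iN jM; first by rewrite add0n row.
  have iN' : i < N by lia.
  have := bip _ _ (vert i j iN jM); rewrite IHi // addSn /=.
  by case: (colour _); case: (colour _); case: (odd _).
have slack_colour x : colour x = colour (g 0 0) -> slack R x.
  have [i [j [iN jM <-]]] := g_onto x; rewrite colourE // => E.
  apply: (slack_even gg) => //; move: E.
  by case: (odd _); case: (colour _).
have edge_on_path k : k != None -> exists a b,
    [/\ a < b, b < n, adj (s a) (s b) & k = edge_of (s a) (s b)].
  case: k => // e _; have [x [y [xy ->]]] := edge_case e.
  have [a an ax] := s_onto x; have [b bn byy] := s_onto y.
  case: (ltngtP a b) => [ab|ba|ab].
  - by exists a, b; rewrite ax byy.
  - by exists b, a; rewrite ax byy adj_sym edge_ofC.
  - by have := adj_neq xy; rewrite -ax -byy ab eqxx.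
move=> f0 h0 Sf.
have Sgrid : grid (fun x y => S (edge_of x y)) N M g.
  have [a [b [ab bn sab fE]]] := edge_on_path f f0.
  have Sa : S (edge_of (s a) (s a.+1)).
    by apply: (S_closed f) => //; rewrite fE; apply: exchange_chord => //; lia.
  (* The path edge found in S is horizontal or vertical; [e] treats both cases. *)
  pose e x y := S (edge_of x y) -> grid (fun x y => S (edge_of x y)) N M g.
  have eline : line e (N * M) s.
    apply: snake_line => [x y|]; first by rewrite /e edge_ofC.
    split=> i j iN jM; rewrite /e => Sij.
      by apply: (grid_exchange gg) => //; exists i, j.
    have := @grid_exchange _ _ _ S (spanning_grid_transpose gg) M1 N1 S_closed.
    by move=> H; apply: (@grid_transpose _ _ M N (fun i j => g j i)); apply: H; exists j, i.
  by apply: (eline a) => //; rewrite NM; lia.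
have Spath k : k.+1 < n -> S (edge_of (s k) (s k.+1)).
  rewrite -NM; apply: (@snake_line G (fun x y => S (edge_of x y)) false N M g) => //.
  by move=> x y; rewrite edge_ofC.
have [a [b [ab bn sab ->]]] := edge_on_path h h0.
have abn : a < b < n by rewrite ab.
have [ca cb] := @slack_chord R G s a b s_ham abn sab.
have [sa|sa] := eqVneq (colour (s a)) (colour (g 0 0)).
  have [_ ex] := ca (slack_colour _ sa).
  apply: S_closed ex; have -> : s b = s b.-1.+1 by congr s; lia.
  by apply: Spath; lia.
have sb : colour (s b) = colour (g 0 0).
  by move: sa (bip _ _ sab); case: (colour _); case: (colour _); case: (colour _).
have [_ ex] := cb (slack_colour _ sb).
by apply: S_closed ex; apply: Spath; lia.
Qed.

End GridGraph.

(** * A spanning grid in a product of paths *)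

Section PathProduct.
Variables (d : nat) (m : 'I_d -> nat).
Hypothesis side_gt1 : forall i, 1 < m i.
Local Notation P := (cprod_graph (fun i : 'I_d => path_graph (m i))).
Local Notation V := {dffun forall i : 'I_d, path_graph (m i)}.

Lemma side_gt0 i : 0 < m i.
Proof. exact: ltnW. Qed.

Definition origin : V := [ffun i => Ordinal (side_gt0 i)].

Definition set_coord (v : V) (i : 'I_d) (a : nat) : V :=
  [ffun j => if (j == i) && (a < m j) then insubd (v j) a else v j].

Lemma set_coord_eq v i a : a < m i -> set_coord v i a i = a :> nat.
Proof. by move=> am; rewrite ffunE eqxx am val_insubd am. Qed.

Lemma set_coord_neq v i a j : j != i -> set_coord v i a j = v j.
Proof. by move=> /negPf ji; rewrite ffunE ji. Qed.

Lemma adj_coord (v w : V) i : (forall j, j != i -> v j = w j) ->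
  (v i).+1 = w i -> cprod_adj v w.
Proof.
move=> vw vwi; apply/existsP; exists i.
rewrite /adj /= /path_adj vwi eqxx /=.
by apply/forallP => j; apply/implyP => /vw->.
Qed.

(** The sequence s is a Hamiltonian path of the product of the factors in L, placed
in the full product with the other coordinates at 0. *)
Definition spans (L : seq 'I_d) (N : nat) (s : nat -> V) :=
  [/\ line (fun x y => cprod_adj x y) N s,
      (forall k l, k < N -> l < N -> s k = s l -> k = l),
      (forall k j, k < N -> j \notin L -> s k j = origin j) &
      (forall v : V, (forall j, j \notin L -> v j = origin j) ->
         exists2 k, k < N & s k = v)].

Definition stack (i : 'I_d) (s : nat -> V) (a k : nat) : V := set_coord (s k) i a.

Lemma stack_grid i L N s : i \notin L -> spans L N s ->
  [/\ grid (fun x y => cprod_adj x y) (m i) N (stack i s),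
      (forall a k a' k', a < m i -> k < N -> a' < m i -> k' < N ->
         stack i s a k = stack i s a' k' -> a = a' /\ k = k'),
      (forall a k j, k < N -> j \notin i :: L -> stack i s a k j = origin j) &
      (forall v : V, (forall j, j \notin i :: L -> v j = origin j) ->
         exists a k, [/\ a < m i, k < N & stack i s a k = v])].
Proof.
move=> iL [s_line s_inj s_supp s_onto]; split.
- split=> [a k am kN|a k am kN].
    apply: (@adj_coord _ _ i) => [j ji|]; first by rewrite !set_coord_neq.
    by rewrite !set_coord_eq // ltnW.
  have /existsP[j /andP[jadj /forallP jeq]] := s_line k kN.
  have ji : j != i.
    apply: contraTneq jadj => ->; rewrite !s_supp //; last by lia.
    by rewrite adj_irr.
  apply/existsP; exists j; rewrite !set_coord_neq // jadj /=.
  apply/forallP => l; apply/implyP => lj.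
  have [->|li] := eqVneq l i; last by rewrite !set_coord_neq //; have := jeq l; rewrite lj.
  by apply/eqP/val_inj; rewrite /= !set_coord_eq.
- move=> a k a' k' am kN am' kN' E; split.
    by rewrite -(set_coord_eq (s k) am) -(set_coord_eq (s k') am') -[set_coord _ _ _]/(stack i s a k) E.
  apply: s_inj => //; apply/ffunP => j.
  have [->|ji] := eqVneq j i; first by rewrite !s_supp.
  by rewrite -(set_coord_neq (s k) a ji) -(set_coord_neq (s k') a' ji) -[set_coord _ _ _]/(stack i s a k) E.
- move=> a k j kN; rewrite inE negb_or => /andP[ji jL].
  by rewrite /stack set_coord_neq // s_supp.
- move=> v v_supp.
  have [|k kN sk] := s_onto (set_coord v i 0).
    move=> j jL; have [->|ji] := eqVneq j i.
      by apply/val_inj; rewrite /= set_coord_eq ?side_gt0 // ffunE.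
    by rewrite set_coord_neq // v_supp // inE negb_or ji.
  exists (v i : nat), k; have vm : v i < m i by exact: (@ltn_ord (m i) (v i)).
  split=> //.
  apply/ffunP => j; have [->|ji] := eqVneq j i.
    by apply/val_inj; rewrite /= set_coord_eq.
  by rewrite /stack sk !set_coord_neq.
Qed.

(** By induction on the list of factors: a new factor makes a path into a grid, and
a grid has a boustrophedon path. *)
Lemma spans_exists L : uniq L -> exists s, spans L (\prod_(i <- L) m i) s.
Proof.
elim: L => [_|i L IHL /= /andP[iL /IHL[s s_spans]]].
  exists (fun=> origin); rewrite big_nil; split=> //.
  - by move=> [|k] [|l].
  - by move=> v v0; exists 0 => //; apply/ffunP => j; rewrite v0.
have [g_grid g_inj g_supp g_onto] := stack_grid iL s_spans.
rewrite big_cons; set N := \prod_(j <- L) _ in s_spans g_grid g_inj g_supp g_onto *.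
exists (snake false N (stack i s)); split.
- by apply: snake_line g_grid => x y; rewrite cprod_adj_sym.
- move=> k l kN lN.
  have [a [b [am bN ->]]] := snake_posP false kN.
  have [a' [b' [am' bN' ->]]] := snake_posP false lN.
  by rewrite !snakeE // => /g_inj[] // -> ->.
- move=> k j kN jL; have [a [b [am bN ->]]] := snake_posP false kN.
  by rewrite snakeE // g_supp.
- move=> v v0; have [a [b [am bN <-]]] := g_onto v v0.
  by exists (snake_pos false N a b); rewrite ?snakeE // snake_pos_lt.
Qed.

Lemma parity_adj (x y : V) : cprod_adj x y ->
  odd (\sum_i x i) != odd (\sum_i y i).
Proof.
case/existsP=> i /andP[xyi /forallP xyj].
rewrite (bigD1 i) //= [\sum_i y i](bigD1 i) //=.
rewrite (eq_bigr (fun j => y j : nat)) => [|j ji].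
  rewrite !oddD; move: xyi; rewrite /adj /= /path_adj.
  by case/orP=> /eqP <-; rewrite /= addNb; case: (odd (_ : nat) (+) _).
by have := xyj j; rewrite ji => /eqP->.
Qed.

(** The first factor is one side.  The other factors, of which there is at least
one, provide the other side. *)
Lemma spanning_grid_product : 1 < d ->
  exists N M g, [/\ 1 < N, 1 < M & @spanning_grid P N M g].
Proof.
move=> d1; pose i0 : 'I_d := Ordinal (ltnW d1); pose i1 : 'I_d := Ordinal d1.
pose L := rem i0 (enum 'I_d).
have Luniq : uniq L by rewrite rem_uniq ?enum_uniq.
have LE j : (j \in L) = (j != i0) by rewrite mem_rem_uniq ?enum_uniq // inE mem_enum andbT.
have [s s_spans] := spans_exists Luniq.
have i0L : i0 \notin L by rewrite LE eqxx.
have [g_grid g_inj _ g_onto] := stack_grid i0L s_spans.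
set M := \prod_(i <- L) m i in s_spans g_grid g_inj g_onto.
have M1 : 1 < M.
  rewrite /M (big_rem i1) /=; last by rewrite LE.
  have : 0 < \prod_(i <- rem i1 L) m i by apply: prodn_gt0 => i; exact: side_gt0.
  by have := side_gt1 i1; case: (\prod_(i <- _) _) => // k; rewrite mulnS; lia.
exists (m i0), M, (stack i0 s); split=> //.
have onto (v : V) : exists a k, [/\ a < m i0, k < M & stack i0 s a k = v].
  by apply: g_onto => j; rewrite inE LE; case: eqP.
split=> //.
pose f (p : 'I_(m i0) * 'I_M) : V := stack i0 s p.1 p.2.
have f_inj : injective f.
  move=> [a k] [a' k'] /g_inj[] //= E1 E2.
  by congr pair; apply: val_inj.
rewrite -[LHS](_ : #|{: 'I_(m i0) * 'I_M}| = _); last by rewrite card_prod !card_ord.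
rewrite -(card_codom f_inj) /graph_order; apply: eq_card => v.
have [a [k [am kM <-]]] := onto v.
by rewrite inE; apply/codomP; exists (Ordinal am, Ordinal kM).
Qed.

End PathProduct.

Theorem theorem4p6 (R : realType) (d : nat) (n : 'I_d -> nat)
    (hd : (2 <= d)%N) (hn : forall i : 'I_d, (2 <= n i)%N) :
  resistance_nonnegative R (cprod_graph (fun i : 'I_d => path_graph (n i))).
Proof.
have [N [M [g [N1 M1 gg]]]] := spanning_grid_product hn hd.
have H := @resistance_nonnegative_grid R _ N M g _ gg N1 M1 (@parity_adj d n).
exact: H.
Qed.
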